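(* Let $\mathsf{H}_c$ be the rational Cherednik algebra attached to a finite Coxeter group $W$ in a complex vector space $\mathfrak{h}$ and a $W$-invariant function $c$. For any simple object $M\in\mathcal{O}(\mathsf{H}_c)$, the variety $\mathcal{S}upp\,M\subset\mathfrak{h}\oplus\mathfrak{h}^*$ is the $W$-saturation of the vector subspace $\mathfrak{h}^G\oplus\{0\}$, for a certain parabolic subgroup $G\in\mathtt{Parab}(W)$.
   Context: $W$ is a finite Coxeter group acting in $\mathfrak{h}$, the complexification of a real Euclidean space with inner product $(-,-)$; $W$ is generated by a finite set $S\subset W$ of reflections $s$ with respect to hyperplanes $H_s$ ($S$ is $W$-stable under conjugation). For $s\in S$, $\alpha_s\in\mathfrak{h}^*$ is a nonzero linear function vanishing on $H_s$, and $\alpha_s^\vee=2(\alpha_s,-)/(\alpha_s,\alpha_s)\in\mathfrak{h}$. For a $W$-invariant function $c:S\to\mathbb{C}$, $s\mapsto c_s$, the rational Cherednik algebra $\mathsf{H}_c$ is the $\mathbb{C}$-algebra generated by $\mathfrak{h}$, $\mathfrak{h}^*$ and $W$ with the relations of $W$ and $wxw^{-1}=w(x)$, $wyw^{-1}=w(y)$, $x_1x_2=x_2x_1$, $y_1y_2=y_2y_1$, $yx-xy=\langle y,x\rangle+\sum_{s\in S}c_s\langle y,\alpha_s\rangle\langle\alpha_s^\vee,x\rangle s$ for $w\in W$, $x,x_i\in\mathfrak{h}^*$, $y,y_i\in\mathfrak{h}$. The subalgebra generated by $\mathfrak{h}^*$ is $\mathbb{C}[\mathfrak{h}]$, the one generated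 by $\mathfrak{h}$ is $\mathbb{C}[\mathfrak{h}^*]$. $\mathcal{O}(\mathsf{H}_c)$ is the category of finitely generated left $\mathsf{H}_c$-modules on which the action of $\mathbb{C}[\mathfrak{h}^*]^W$ is locally finite. $\mathsf{H}_c$ is filtered with $\mathbb{C}W$ in degree $0$ and $\mathfrak{h},\mathfrak{h}^*$ in degree $1$, and $\mathrm{gr}\,\mathsf{H}_c\simeq\mathbb{C}[\mathfrak{h}\oplus\mathfrak{h}^*]\#W$ (with $x\in\mathfrak{h}^*$, $y\in\mathfrak{h}$ viewed as linear functions on $\mathfrak{h}$, resp. $\mathfrak{h}^*$). For a finitely generated $\mathsf{H}_c$-module $M$, choose a good filtration (compatible, with $\mathrm{gr}\,M$ finitely generated over $\mathrm{gr}\,\mathsf{H}_c$); $\mathcal{S}upp\,M\subset\mathfrak{h}\oplus\mathfrak{h}^*$ is the ($W$-stable, reduced) support of $\mathrm{gr}\,M$ as a $\mathbb{C}[\mathfrak{h}\oplus\mathfrak{h}^*]$-module; it is independent of the choice of good filtration. $\mathtt{Parab}(W)$ is the set of parabolic subgroups of $W$, i.e. isotropy groups in $W$ of points of $\mathfrak{h}$; $\mathfrak{h}^G$ is the subspace of $G$-fixed vectors. *)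

(* Defs.v *)
From HB Require Import structures.
From mathcomp Require Import mpoly.
From mathcomp Require Import all_boot all_order all_algebra all_fingroup.
From mathcomp Require Import generic_quotient mxrepresentation.
From mathcomp Require Import boolp classical_sets reals complex.

Set Implicit Arguments.
Unset Strict Implicit.
Unset Printing Implicit Defensive.

Import Order.TTheory GRing.Theory Num.Theory.
Local Open Scope classical_set_scope.
Local Open Scope ring_scope.
Local Open Scope quotient_scope.

(* Rings and modules are pzRingType / lmodType: these do not require 1 != 0,
   so that algebras can be given by generators and relations. *)

Section Modules.
Variables (A : pzRingType) (M : lmodType A).

Definition fin_gen : Prop :=
  exists e : seq M, forall m : M,
    exists a : nat -> A, m = \sum_(i < size e) a i *: e`_i.

Definition submodule (N : set M) : Prop :=
  [/\ N 0, forall u v, N u -> N v -> N (u + v)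
    & forall (a : A) u, N u -> N (a *: u)].

Definition simple_module : Prop :=
  (exists m : M, m <> 0) /\
  forall N : set M, submodule N -> N = [set 0] \/ N = setT.

End Modules.

Record ring_filtration (A : pzRingType) := RingFiltration {
  rfil :> nat -> set A;
  rfil0 : forall i, rfil i 0;
  rfilB : forall i a b, rfil i a -> rfil i b -> rfil i (a - b);
  rfil1 : rfil 0 1;
  rfilM : forall i j a b, rfil i a -> rfil j b -> rfil (i + j) (a * b);
  rfilS : forall i, rfil i `<=` rfil i.+1;
  rfil_exhaustive : forall a, exists i, rfil i a
}.

Record mod_filtration (A : pzRingType) (F : ring_filtration A)
    (M : lmodType A) := ModFiltration {
  mfil :> nat -> set M;
  mfil0 : forall i, mfil i 0;
  mfilB : forall i u v, mfil i u -> mfil i v -> mfil i (u - v);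
  mfilZ : forall i j a u, F i a -> mfil j u -> mfil (i + j) (a *: u);
  mfilS : forall i, mfil i `<=` mfil i.+1;
  mfil_exhaustive : forall u, exists i, mfil i u
}.

(* The associated graded group, the direct sum over i of G_i / G_(i-1) with
   G_(-1) = 0: finitely supported sequences (u_i) with u_i in G_i, modulo the
   sequences with u_i in G_(i-1). *)
Section Graded.
Variables (A : pzRingType) (F : ring_filtration A) (M : lmodType A).
Variable G : mod_filtration F M.

Definition mfil_pred (i : nat) : set M := if i is j.+1 then G j else [set 0].

Record rees := Rees {
  rees_seq :> nat -> M;
  reesP : forall i, G i (rees_seq i);
  rees_fin : exists N, forall i, (N <= i)%N -> rees_seq i = 0
}.

HB.instance Definition _ := gen_eqMixin rees.
HB.instance Definition _ := gen_choiceMixin rees.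

Definition rees_eq (u v : rees) : bool :=
  `[< forall i, mfil_pred i (u i - v i) >].

Lemma mfil_pred0 i : mfil_pred i 0.
Proof. by case: i => //= i; apply: mfil0. Qed.

Lemma mfil_predB i u v : mfil_pred i u -> mfil_pred i v -> mfil_pred i (u - v).
Proof.
case: i => [|i] /=; first by move=> -> ->; rewrite subr0.
exact: mfilB.
Qed.

Lemma mfil_predN i u : mfil_pred i u -> mfil_pred i (- u).
Proof. by move=> hu; rewrite -sub0r; apply/mfil_predB/hu/mfil_pred0. Qed.

Lemma mfil_predD i u v : mfil_pred i u -> mfil_pred i v -> mfil_pred i (u + v).
Proof. by move=> hu hv; rewrite -[v]opprK; apply/mfil_predB/mfil_predN. Qed.

Lemma mfilN i u : G i u -> G i (- u).
Proof. by move=> hu; rewrite -sub0r; apply/mfilB/hu/mfil0. Qed.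

Lemma mfilD i u v : G i u -> G i v -> G i (u + v).
Proof. by move=> hu hv; rewrite -[v]opprK; apply/mfilB/mfilN. Qed.

Lemma rees_eq_refl : reflexive rees_eq.
Proof. by move=> u; apply/asboolP => i; rewrite subrr; apply: mfil_pred0. Qed.

Lemma rees_eq_sym : symmetric rees_eq.
Proof.
suff h u v : rees_eq u v -> rees_eq v u by move=> u v; apply/idP/idP => /h.
move=> /asboolP huv; apply/asboolP => i.
by rewrite -opprB; apply: mfil_predN.
Qed.

Lemma rees_eq_trans : transitive rees_eq.
Proof.
move=> v u w /asboolP huv /asboolP hvw; apply/asboolP => i.
by rewrite -(subrKA (v i)); apply: mfil_predD.
Qed.

Canonical rees_equiv :=
  EquivRel rees_eq rees_eq_refl rees_eq_sym rees_eq_trans.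

Definition graded := {eq_quot rees_eq}.
HB.instance Definition _ := Choice.on graded.
HB.instance Definition _ := EqQuotient.on graded.

Lemma graded_eqP (u v : rees) :
  \pi_graded u = \pi_graded v <-> forall i, mfil_pred i (u i - v i).
Proof.
split=> [/eqP|h]; first by rewrite eqmodE => /asboolP.
by apply/eqP; rewrite eqmodE; apply/asboolP.
Qed.

Lemma rees_ext (u v : rees) : u =1 v -> u = v.
Proof.
case: u v => [u uP uf] [v vP vf] /= /funext huv.
by subst v; congr Rees; apply: Prop_irrelevance.
Qed.

Lemma reesBP (u v : rees) : forall i, G i (u i - v i).
Proof. by move=> i; apply: mfilB; apply: reesP. Qed.
Lemma reesB_fin (u v : rees) :
  exists N, forall i, (N <= i)%N -> u i - v i = 0.
Proof.
have [[N hN] [K hK]] := (rees_fin u, rees_fin v).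
exists (maxn N K) => i; rewrite geq_max => /andP[hi1 hi2].
by rewrite hN ?hK ?subr0.
Qed.
Definition rees_sub u v := Rees (reesBP u v) (reesB_fin u v).

Lemma rees0_fin : exists N, forall i, (N <= i)%N -> (0 : M) = 0.
Proof. by exists 0%N. Qed.
Definition rees0 := @Rees (fun=> 0) (fun i => mfil0 G i) rees0_fin.

Definition rees_opp u := rees_sub rees0 u.
Definition rees_add u v := rees_sub u (rees_opp v).

Definition graded0 : graded := \pi_graded rees0.
Definition graded_opp (x : graded) : graded := \pi_graded (rees_opp (repr x)).
Definition graded_add (x y : graded) : graded :=
  \pi_graded (rees_add (repr x) (repr y)).

Lemma graded_reprP (u : rees) i : mfil_pred i (repr (\pi_graded u) i - u i).
Proof. by move: i; apply/graded_eqP; rewrite reprK. Qed.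

Lemma pi_rees_add u v :
  \pi_graded (rees_add u v) = graded_add (\pi u) (\pi v).
Proof.
apply/graded_eqP => i /=; rewrite !sub0r !opprK.
rewrite opprD addrACA -opprB -[v i - _]opprB -opprD.
by apply/mfil_predN/mfil_predD; rewrite ?opprB; apply: graded_reprP.
Qed.

Lemma pi_rees_opp u : \pi_graded (rees_opp u) = graded_opp (\pi u).
Proof.
apply/graded_eqP => i /=; rewrite !sub0r opprK addrC.
exact: graded_reprP.
Qed.

Fact graded_addA : associative graded_add.
Proof.
elim/quotW=> u; elim/quotW=> v; elim/quotW=> w.
rewrite -!pi_rees_add; congr \pi; apply: rees_ext => i /=.
by rewrite !sub0r !opprK addrA.
Qed.

Fact graded_addC : commutative graded_add.
Proof.
elim/quotW=> u; elim/quotW=> v.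
rewrite -!pi_rees_add; congr \pi; apply: rees_ext => i /=.
by rewrite !sub0r !opprK addrC.
Qed.

Fact graded_add0 : left_id graded0 graded_add.
Proof.
elim/quotW=> u; rewrite -!pi_rees_add; congr \pi; apply: rees_ext => i /=.
by rewrite !sub0r !opprK.
Qed.

Fact graded_addN : left_inverse graded0 graded_opp graded_add.
Proof.
elim/quotW=> u; rewrite -pi_rees_opp -!pi_rees_add.
by congr \pi; apply: rees_ext => i /=; rewrite !sub0r !opprK addNr.
Qed.

HB.instance Definition _ := GRing.isZmodule.Build graded
  graded_addA graded_addC graded_add0 graded_addN.

Lemma pi_reesD u v :
  \pi_graded (rees_add u v) = \pi_graded u + \pi_graded v.
Proof. exact: pi_rees_add. Qed.

(* the class of u in G_d / G_(d-1), for u in G_d *)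
Section Symbol.
Variables (d : nat) (u : M) (hu : G d u).
Lemma symbP i : G i (if i == d then u else 0).
Proof. by case: eqP => [->|_] //; apply: mfil0. Qed.
Lemma symb_fin :
  exists N, forall i, (N <= i)%N -> (if i == d then u else 0) = 0.
Proof. by exists d.+1 => i; case: eqP => [->|//]; rewrite ltnn. Qed.
Definition symb : graded := \pi_graded (Rees symbP symb_fin).
End Symbol.

End Graded.

Section RegularFiltration.
Variables (A : pzRingType) (F : ring_filtration A).

Definition reg_filtration : mod_filtration F A^o :=
  @ModFiltration A F A^o F (@rfil0 A F) (@rfilB A F) (@rfilM A F)
    (@rfilS A F) (@rfil_exhaustive A F).

End RegularFiltration.

(* Multiplication in gr A and its action on gr M are both induced by
   (p . u)_k = \sum_(i + j = k) p_i u_j. *)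
Section Conv.
Variables (A : pzRingType) (M : lmodType A).

Definition conv (p : nat -> A) (u : nat -> M) (k : nat) : M :=
  \sum_(i < k.+1) p i *: u (k - i)%N.

End Conv.


Section ConvTheory.
Variables (A : pzRingType) (F : ring_filtration A).

Lemma convA (M : lmodType A) (p q : nat -> A) (u : nat -> M) :
  conv (M := M) (conv (M := A^o) p q) u =1 conv p (conv q u).
Proof.
move=> k; rewrite /conv.
pose f i j := (p j * q (i - j)%N) *: u (k - i)%N.
transitivity (\sum_(0 <= i < k.+1) \sum_(0 <= j < k.+1 | (j <= i)%N) f i j).
  rewrite big_mkord; apply: eq_bigr => i _; rewrite scaler_suml.
  rewrite -(big_mkord xpredT (f i)) (big_nat_widen 0 _ k.+1) //.
rewrite (exchange_big_dep_nat xpredT) //= big_mkord; apply: eq_bigr => j _.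
rewrite -(@big_nat_widenl _ _ _ j 0 k.+1 xpredT (f^~ j)) //.
rewrite -{1}[val j]add0n big_addn subSn; last by rewrite -ltnS ltn_ord.
rewrite big_mkord scaler_sumr; apply: eq_bigr => i _.
by rewrite /f addnK scalerA subnDA subnAC.
Qed.

Variables (M : lmodType A) (G : mod_filtration F M).

Lemma fil_sum (I : finType) (f : I -> M) k :
  (forall i, G k (f i)) -> G k (\sum_i f i).
Proof. by move=> h; elim/big_ind: _ => //; [apply: mfil0 | apply: mfilD]. Qed.

Lemma fil_pred_sum (I : finType) (f : I -> M) k :
  (forall i, mfil_pred G k (f i)) -> mfil_pred G k (\sum_i f i).
Proof.
by move=> h; elim/big_ind: _ => //; [apply: mfil_pred0 | apply: mfil_predD].
Qed.

Local Notation gF := (reg_filtration F).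

Lemma mfil_predZl i j (a : A) (u : M) :
  mfil_pred gF i a -> G j u -> mfil_pred G (i + j) (a *: u).
Proof.
case: i => [->|i] /=; last exact: mfilZ.
by rewrite scale0r => _; apply: mfil_pred0.
Qed.

Lemma mfil_predZr i j (a : A) (u : M) :
  F i a -> mfil_pred G j u -> mfil_pred G (i + j) (a *: u).
Proof.
case: j => [ha ->|j]; first by rewrite scaler0; apply: mfil_pred0.
by rewrite addnS; apply: mfilZ.
Qed.

Lemma rees_actP (p : rees gF) (u : rees G) k : G k (conv (M := M) p u k).
Proof.
apply: fil_sum => i; rewrite -{1}(subnKC (leq_ord i)).
by apply: mfilZ; [exact: (reesP p) | exact: reesP].
Qed.

Lemma rees_act_fin (p : rees gF) (u : rees G) :
  exists N, forall k, (N <= k)%N -> conv (M := M) p u k = 0.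
Proof.
have [[N hN] [K hK]] := (rees_fin p, rees_fin u).
exists (N + K)%N => k hk; apply: big1 => i _.
have [/hN ->|hi] := leqP N i; first by rewrite scale0r.
rewrite hK ?scaler0 // leq_subRL ?leq_ord //.
by apply: leq_trans hk; rewrite leq_add2r ltnW.
Qed.

Definition rees_act p u : rees G := Rees (rees_actP p u) (rees_act_fin p u).

Definition graded_act (x : graded gF) (y : graded G) : graded G :=
  \pi_(graded G) (rees_act (repr x) (repr y)).

Lemma pi_rees_act (p : rees gF) (u : rees G) :
  \pi_(graded G) (rees_act p u) = graded_act (\pi p) (\pi u).
Proof.
apply/esym/graded_eqP => k /=; rewrite /conv -sumrB; apply: fil_pred_sum => i.
set p' := repr _; set u' := repr _.
rewrite -(subrKA ((p i : A) *: u' (k - i)%N)) -scalerBl -scalerBr.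
rewrite -{1}(subnKC (leq_ord i)); apply: mfil_predD.
  by apply: mfil_predZl; [exact: (graded_reprP p) | exact: reesP].
by apply: mfil_predZr; [exact: (reesP p) | exact: graded_reprP].
Qed.

Lemma graded_actDl x y u :
  graded_act (x + y) u = graded_act x u + graded_act y u.
Proof.
elim/quotW: x => p; elim/quotW: y => q; elim/quotW: u => u.
rewrite -pi_reesD -!pi_rees_act -pi_reesD; congr \pi; apply: rees_ext => k /=.
rewrite !sub0r !opprK /conv -big_split; apply: eq_bigr => i _ /=.
by rewrite sub0r opprK scalerDl.
Qed.

Lemma graded_actDr x u v :
  graded_act x (u + v) = graded_act x u + graded_act x v.
Proof.
elim/quotW: x => p; elim/quotW: u => u; elim/quotW: v => v.
rewrite -pi_reesD -!pi_rees_act -pi_reesD; congr \pi; apply: rees_ext => k /=.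
rewrite !sub0r !opprK /conv -big_split; apply: eq_bigr => i _ /=.
by rewrite sub0r opprK scalerDr.
Qed.

Definition gr_one : graded gF := symb (G := gF) (rfil1 F).

Lemma graded_act1 u : graded_act gr_one u = u.
Proof.
elim/quotW: u => u; rewrite -pi_rees_act; congr \pi; apply: rees_ext => k /=.
rewrite /conv big_ord_recl /= scale1r subn0 big1 ?addr0 // => i _.
by rewrite scale0r.
Qed.

End ConvTheory.

Definition gr_ring (A : pzRingType) (F : ring_filtration A) :=
  graded (reg_filtration F).

Section GradedRing.
Variables (A : pzRingType) (F : ring_filtration A).
Local Notation gr := (gr_ring F).

HB.instance Definition _ := GRing.Zmodule.on gr.

Definition gr_mul (x y : gr) : gr := graded_act x y.

Lemma graded_actA (M : lmodType A) (G : mod_filtration F M) (x y : gr)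
    (u : graded G) :
  graded_act x (graded_act y u) = graded_act (gr_mul x y) u.
Proof.
elim/quotW: x => p; elim/quotW: y => q; elim/quotW: u => u.
rewrite /gr_mul -!pi_rees_act; congr \pi; apply: rees_ext => k /=.
by rewrite -convA.
Qed.

Lemma gr_mulA : associative gr_mul.
Proof. by move=> x y z; apply: graded_actA. Qed.

Lemma gr_mul1r : left_id (gr_one F) gr_mul.
Proof. exact: graded_act1. Qed.

Lemma gr_mulr1 : right_id (gr_one F) gr_mul.
Proof.
elim/quotW=> p; rewrite /gr_mul -pi_rees_act; congr \pi.
apply: rees_ext => k /=.
rewrite /conv big_ord_recr /= subnn big1 ?add0r; first exact: mulr1.
move=> i _; rewrite subn_eq0 leqNgt ltn_ord; exact: mulr0.
Qed.

Lemma gr_mulDl : left_distributive gr_mul +%R.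
Proof. by move=> x y z; apply: graded_actDl. Qed.

Lemma gr_mulDr : right_distributive gr_mul +%R.
Proof. by move=> x y z; apply: graded_actDr. Qed.

HB.instance Definition _ := GRing.Zmodule_isPzRing.Build gr
  gr_mulA gr_mul1r gr_mulr1 gr_mulDl gr_mulDr.

Section GradedModule.
Variables (M : lmodType A) (G : mod_filtration F M).

Lemma graded_scaleDl (u : graded G) :
  {morph (fun x : gr => graded_act x u) : x y / x + y}.
Proof. by move=> x y; apply: graded_actDl. Qed.

HB.instance Definition _ := GRing.Zmodule_isLmodule.Build gr (graded G)
  (@graded_actA M G) (@graded_act1 A F M G) (@graded_actDr A F M G)
  graded_scaleDl.

Definition good_filtration : Prop := @fin_gen gr (graded G).

End GradedModule.
End GradedRing.

Section GoodFiltration.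
Variables (A : pzRingType) (F : ring_filtration A) (M : lmodType A).

Lemma rfil_leq i j : (i <= j)%N -> F i `<=` F j.
Proof.
move=> /subnKC <-; elim: (j - i)%N => [|k ih] a; first by rewrite addn0.
by move=> /ih h; rewrite addnS; apply: rfilS.
Qed.

Variable e : seq M.

Definition gen_fil (i : nat) : set M := [set u |
  exists2 a : nat -> A, forall k, F i (a k) & u = \sum_(k < size e) a k *: e`_k].

Lemma gen_fil0 i : gen_fil i 0.
Proof.
exists (fun=> 0) => [_|]; first exact: rfil0.
by rewrite big1 // => k _; rewrite scale0r.
Qed.

Lemma gen_filB i u v : gen_fil i u -> gen_fil i v -> gen_fil i (u - v).
Proof.
move=> [a ha ->] [b hb ->]; exists (fun k => a k - b k) => [k|].
  exact: rfilB.
by rewrite -sumrB; apply: eq_bigr => k _; rewrite scalerBl.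
Qed.

Lemma gen_filZ i j a u : F i a -> gen_fil j u -> gen_fil (i + j) (a *: u).
Proof.
move=> ha [b hb ->]; exists (fun k => a * b k) => [k|]; first exact: rfilM.
by rewrite scaler_sumr; apply: eq_bigr => k _; rewrite scalerA.
Qed.

Lemma gen_filS i : gen_fil i `<=` gen_fil i.+1.
Proof. by move=> u [a ha ->]; exists a => // k; apply: rfilS. Qed.

Hypothesis eP : forall m : M,
  exists a : nat -> A, m = \sum_(k < size e) a k *: e`_k.

Lemma gen_fil_exhaustive u : exists i, gen_fil i u.
Proof.
have [a ->] := eP u.
have /choice [d hd] := fun k : nat => rfil_exhaustive F (a k).
exists (\max_(k < size e) d k)%N.
exists (fun k => if (k < size e)%N then a k else 0) => [k|].
  case: ifP => hk; last exact: rfil0.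
  by apply: rfil_leq (hd k); apply: (leq_bigmax (Ordinal hk)).
by apply: eq_bigr => k _; rewrite ltn_ord.
Qed.

Definition gen_filtration : mod_filtration F M :=
  ModFiltration gen_fil0 gen_filB gen_filZ gen_filS gen_fil_exhaustive.

Lemma gen_fil_gen k : gen_filtration 0 e`_k.
Proof.
have [hk|hk] := ltnP k (size e); last by rewrite nth_default //; apply: gen_fil0.
exists (fun j => if j == k then 1 else 0) => [j|].
  by case: eqP => _; [apply: rfil1 | apply: rfil0].
rewrite (bigD1 (Ordinal hk)) //= eqxx scale1r big1 ?addr0 // => j.
by rewrite -val_eqE /= => /negbTE ->; rewrite scale0r.
Qed.

Lemma conv_symb0 (p : nat -> A) (u : M) i :
  conv p (fun j => if j == 0%N then u else 0) i = p i *: u.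
Proof.
rewrite /conv big_ord_recr /= subnn big1 ?add0r // => j _.
by rewrite subn_eq0 leqNgt ltn_ord scaler0.
Qed.

Lemma gen_filtration_good : good_filtration gen_filtration.
Proof.
exists (mkseq (fun k => symb (gen_fil_gen k)) (size e)); elim/quotW=> u.
rewrite size_mkseq.
have [N hN] := rees_fin u.
have /choice [a /all_and2[ha hu]] : forall i, exists a : nat -> A,
    (forall k, F i (a k)) /\ u i = \sum_(k < size e) a k *: e`_k.
  by move=> i; have [a ha hu] := reesP u i; exists a.
pose b k i := if (i < N)%N then a i k else 0.
have bP k i : reg_filtration F i (b k i).
  by rewrite /b; case: ifP => _; [apply: ha | apply: rfil0].
have bF k : exists N, forall i, (N <= i)%N -> b k i = 0.
  by exists N => i; rewrite /b leqNgt => /negbTE ->.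
exists (fun k => \pi_(graded (reg_filtration F)) (Rees (bP k) (bF k))).
transitivity (\sum_(k < size e) \pi_(graded gen_filtration)
    (rees_act (Rees (bP k) (bF k)) (Rees (symbP (gen_fil_gen k)) (symb_fin _ _)))).
  have h0 : \pi_(graded gen_filtration) (rees0 gen_filtration) = 0 by [].
  rewrite -(big_morph _ (@pi_reesD A F M gen_filtration) h0).
  congr \pi; apply: rees_ext => i.
  have -> : forall (r : seq 'I_(size e)) f,
      (\big[@rees_add A F M gen_filtration/rees0 _]_(k <- r) f k) i = \sum_(k <- r) f k i.
    move=> r f; elim: r => [|k r ih]; first by rewrite !big_nil.
    by rewrite !big_cons /= sub0r opprK ih.
  under eq_bigr do rewrite /= conv_symb0 /b.
  have [hi|hi] := ltnP i N; first by rewrite hu.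
  by rewrite hN // big1 // => k _; rewrite scale0r.
apply: eq_bigr => k _; rewrite nth_mkseq // pi_rees_act; congr graded_act.
Qed.

End GoodFiltration.

Lemma exists_good_filtration (A : pzRingType) (F : ring_filtration A)
    (M : lmodType A) :
  fin_gen M -> exists G : mod_filtration F M, good_filtration G.
Proof. by move=> [e eP]; exists (gen_filtration F eP); apply: gen_filtration_good. Qed.

(* W acts on the real space 'cV[R]_n by the matrices rho w, and on its
   complexification h = 'cV[R[i]]_n by the same matrices.  The dual h^* is
   'rV[R[i]]_n, with pairing <y, x> = x y. *)
Section Reflections.
Variables (R : realType) (n : nat).

(* the Gram matrix of a Euclidean inner product on 'cV[R]_n *)
Definition is_gram (B : 'M[R]_n) : Prop :=
  B^T = B /\ forall u : 'cV[R]_n, u != 0 -> 0 < (u^T *m B *m u) 0 0.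

Definition is_reflection (B s : 'M[R]_n) : Prop :=
  exists2 v : 'cV[R]_n, v != 0 &
    forall u : 'cV[R]_n, s *m u =
      u - (2 * (u^T *m B *m v) 0 0 / (v^T *m B *m v) 0 0) *: v.

Definition pairing (y : 'cV[R[i]]_n) (x : 'rV[R[i]]_n) : R[i] := (x *m y) 0 0.

(* 2 (a, -) / (a, a): the form on h^* has matrix B^-1, so (a, -) is the column
   vector B^-1 a^T. *)
Definition coroot (B : 'M[R]_n) (a : 'rV[R[i]]_n) : 'cV[R[i]]_n :=
  let B' := invmx (map_mx (real_complex R) B) in
  (2 / (a *m B' *m a^T) 0 0) *: (B' *m a^T).

Variables (W : finGroupType) (rho : mx_representation R [set: W]%G n).

Definition act_h (w : W) (y : 'cV[R[i]]_n) : 'cV[R[i]]_n :=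
  map_mx (real_complex R) (rho w) *m y.

Definition act_hdual (w : W) (x : 'rV[R[i]]_n) : 'rV[R[i]]_n :=
  x *m map_mx (real_complex R) (rho w^-1%g).

(* H_s is the fixed space of the reflection s. *)
Definition is_root (s : W) (a : 'rV[R[i]]_n) : Prop :=
  a != 0 /\ forall y, act_h s y = y -> pairing y a = 0.

Definition parabolic (P : {set W}) : Prop :=
  exists v, P = [set w | act_h w v == v]%SET.

(* h^P + {0} as a subset of h + h^* *)
Definition fixed_space (P : {set W}) : set ('cV[R[i]]_n * 'rV[R[i]]_n) :=
  [set p | (forall w, w \in P -> act_h w p.1 = p.1) /\ p.2 = 0].

Definition saturation (Z : set ('cV[R[i]]_n * 'rV[R[i]]_n)) :
    set ('cV[R[i]]_n * 'rV[R[i]]_n) :=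
  [set q | exists w p, Z p /\ q = (act_h w p.1, act_hdual w p.2)].

End Reflections.

Section Cherednik.
Variables (R : realType) (n : nat) (W : finGroupType).
Variables (rho : mx_representation R [set: W]%G n) (B : 'M[R]_n).
Variables (S : {set W}) (alpha : W -> 'rV[R[i]]_n) (c : W -> R[i]).

(* The algebra is the set of algebraic expressions in the generators, modulo
   the congruence generated by the axioms of associative unital R[i]-algebras,
   the linearity of the inclusions of h and h^*, and the defining relations. *)
Inductive cterm : Type :=
  | Cst of R[i]
  | Xgen of 'rV[R[i]]_n
  | Ygen of 'cV[R[i]]_n
  | Wgen of W
  | Add of cterm & cterm
  | Mul of cterm & cterm.

Inductive crel : cterm -> cterm -> Prop :=
  | crel_refl a : crel a a
  | crel_sym a b : crel a b -> crel b a
  | crel_trans a b d : crel a b -> crel b d -> crel a d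
  | crel_add a a' b b' : crel a a' -> crel b b' -> crel (Add a b) (Add a' b')
  | crel_mul a a' b b' : crel a a' -> crel b b' -> crel (Mul a b) (Mul a' b')
  | crel_addA a b d : crel (Add a (Add b d)) (Add (Add a b) d)
  | crel_addC a b : crel (Add a b) (Add b a)
  | crel_add0 a : crel (Add (Cst 0) a) a
  | crel_mul0 a : crel (Mul (Cst 0) a) (Cst 0)
  | crel_mulA a b d : crel (Mul a (Mul b d)) (Mul (Mul a b) d)
  | crel_mul1 a : crel (Mul (Cst 1) a) a
  | crel_mulDl a b d : crel (Mul (Add a b) d) (Add (Mul a d) (Mul b d))
  | crel_mulDr a b d : crel (Mul a (Add b d)) (Add (Mul a b) (Mul a d))
  | crel_cstD k l : crel (Cst (k + l)) (Add (Cst k) (Cst l))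
  | crel_cstM k l : crel (Cst (k * l)) (Mul (Cst k) (Cst l))
  | crel_cstC k a : crel (Mul (Cst k) a) (Mul a (Cst k))
  | crel_XD x x' : crel (Xgen (x + x')) (Add (Xgen x) (Xgen x'))
  | crel_XZ k x : crel (Xgen (k *: x)) (Mul (Cst k) (Xgen x))
  | crel_YD y y' : crel (Ygen (y + y')) (Add (Ygen y) (Ygen y'))
  | crel_YZ k y : crel (Ygen (k *: y)) (Mul (Cst k) (Ygen y))
  | crel_W1 : crel (Wgen 1%g) (Cst 1)
  | crel_WM u v : crel (Wgen (u * v)%g) (Mul (Wgen u) (Wgen v))
  | crel_WX w x :
      crel (Mul (Mul (Wgen w) (Xgen x)) (Wgen w^-1%g)) (Xgen (act_hdual rho w x))
  | crel_WY w y :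
      crel (Mul (Mul (Wgen w) (Ygen y)) (Wgen w^-1%g)) (Ygen (act_h rho w y))
  | crel_XX x x' : crel (Mul (Xgen x) (Xgen x')) (Mul (Xgen x') (Xgen x))
  | crel_YY y y' : crel (Mul (Ygen y) (Ygen y')) (Mul (Ygen y') (Ygen y))
  | crel_YX y x :
      crel (Mul (Ygen y) (Xgen x))
        (Add (Mul (Xgen x) (Ygen y))
          (Add (Cst (pairing y x))
            (\big[Add/Cst 0]_(s in S)
              Mul (Cst (c s * pairing y (alpha s)
                            * pairing (coroot B (alpha s)) x)) (Wgen s)))).

HB.instance Definition _ := gen_eqMixin cterm.
HB.instance Definition _ := gen_choiceMixin cterm.

Definition crelb (a b : cterm) : bool := `[< crel a b >].

Lemma crelb_refl : reflexive crelb.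
Proof. by move=> a; apply/asboolP/crel_refl. Qed.

Lemma crelb_sym : symmetric crelb.
Proof. by move=> a b; apply/asboolP/asboolP => /crel_sym. Qed.

Lemma crelb_trans : transitive crelb.
Proof. by move=> b a d /asboolP h /asboolP /(crel_trans h) h'; apply/asboolP. Qed.

Canonical crel_equiv := EquivRel crelb crelb_refl crelb_sym crelb_trans.

Definition cherednik := {eq_quot crelb}.
HB.instance Definition _ := Choice.on cherednik.
HB.instance Definition _ := EqQuotient.on cherednik.

Lemma cherednik_eqP (a b : cterm) :
  \pi_cherednik a = \pi_cherednik b <-> crel a b.
Proof.
split=> [/eqP|h]; first by rewrite eqmodE => /asboolP.
by apply/eqP; rewrite eqmodE; apply/asboolP.
Qed.

Lemma cherednik_reprP (a : cterm) : crel (repr (\pi_cherednik a)) a.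
Proof. by apply/cherednik_eqP; rewrite reprK. Qed.

Definition hcst (k : R[i]) : cherednik := \pi_cherednik (Cst k).
Definition hx (x : 'rV[R[i]]_n) : cherednik := \pi_cherednik (Xgen x).
Definition hy (y : 'cV[R[i]]_n) : cherednik := \pi_cherednik (Ygen y).
Definition hw (w : W) : cherednik := \pi_cherednik (Wgen w).

Definition hadd (a b : cherednik) : cherednik :=
  \pi_cherednik (Add (repr a) (repr b)).
Definition hmul (a b : cherednik) : cherednik :=
  \pi_cherednik (Mul (repr a) (repr b)).
Definition hopp (a : cherednik) : cherednik := hmul (hcst (-1)) a.

Lemma pi_hadd a b : \pi_cherednik (Add a b) = hadd (\pi a) (\pi b).
Proof.
by apply/cherednik_eqP/crel_sym/crel_add; apply: cherednik_reprP.
Qed.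

Lemma pi_hmul a b : \pi_cherednik (Mul a b) = hmul (\pi a) (\pi b).
Proof.
by apply/cherednik_eqP/crel_sym/crel_mul; apply: cherednik_reprP.
Qed.

Fact haddA : associative hadd.
Proof.
elim/quotW=> a; elim/quotW=> b; elim/quotW=> d; rewrite -!pi_hadd.
exact/cherednik_eqP/crel_addA.
Qed.

Fact haddC : commutative hadd.
Proof.
elim/quotW=> a; elim/quotW=> b; rewrite -!pi_hadd.
exact/cherednik_eqP/crel_addC.
Qed.

Fact hadd0 : left_id (hcst 0) hadd.
Proof. elim/quotW=> a; rewrite -pi_hadd; exact/cherednik_eqP/crel_add0. Qed.

Fact hmulA : associative hmul.
Proof.
elim/quotW=> a; elim/quotW=> b; elim/quotW=> d; rewrite -!pi_hmul.
exact/cherednik_eqP/crel_mulA.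
Qed.

Fact hmul1r : left_id (hcst 1) hmul.
Proof. elim/quotW=> a; rewrite -pi_hmul; exact/cherednik_eqP/crel_mul1. Qed.

Fact hcstC k a : hmul (hcst k) a = hmul a (hcst k).
Proof.
elim/quotW: a => a; rewrite -!pi_hmul; exact/cherednik_eqP/crel_cstC.
Qed.

Fact hmulr1 : right_id (hcst 1) hmul.
Proof. by move=> a; rewrite -hcstC hmul1r. Qed.

Fact hmulDl : left_distributive hmul hadd.
Proof.
elim/quotW=> a; elim/quotW=> b; elim/quotW=> d.
rewrite -!(pi_hadd, pi_hmul); exact/cherednik_eqP/crel_mulDl.
Qed.

Fact hmulDr : right_distributive hmul hadd.
Proof.
elim/quotW=> a; elim/quotW=> b; elim/quotW=> d.
rewrite -!(pi_hadd, pi_hmul); exact/cherednik_eqP/crel_mulDr.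
Qed.

Fact hcstD k l : hcst (k + l) = hadd (hcst k) (hcst l).
Proof. by rewrite -pi_hadd; apply/cherednik_eqP/crel_cstD. Qed.

Fact hcstM k l : hcst (k * l) = hmul (hcst k) (hcst l).
Proof. by rewrite -pi_hmul; apply/cherednik_eqP/crel_cstM. Qed.

Fact haddN : left_inverse (hcst 0) hopp hadd.
Proof.
move=> a; rewrite /hopp -{2}[a]hmul1r -hmulDl -hcstD addNr.
elim/quotW: a => a; rewrite -pi_hmul; exact/cherednik_eqP/crel_mul0.
Qed.

HB.instance Definition _ := GRing.isZmodule.Build cherednik
  haddA haddC hadd0 haddN.

HB.instance Definition _ := GRing.Zmodule_isPzRing.Build cherednik
  hmulA hmul1r hmulr1 hmulDl hmulDr.

Lemma hyx y x :
  hy y * hx x - hx x * hy y = hcst (pairing y x) +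
    \sum_(s in S) hcst (c s * pairing y (alpha s)
                          * pairing (coroot B (alpha s)) x) * hw s.
Proof.
have -> : hy y * hx x = \pi_cherednik (Mul (Ygen y) (Xgen x)).
  by rewrite pi_hmul.
have /cherednik_eqP -> := crel_YX y x.
rewrite !pi_hadd pi_hmul -[hadd _ _]/(hx x * hy y + _) addrC addKr.
congr (_ + _).
rewrite (big_morph _ pi_hadd (erefl : _ = 0 :> cherednik)).
by apply: eq_bigr => s _; rewrite pi_hmul.
Qed.

(* the smallest exhaustive algebra filtration with W in degree 0 and h, h^* in
   degree 1 *)
Inductive cherednik_fil_set : nat -> set cherednik :=
  | cfil_cst k : cherednik_fil_set 0 (hcst k)
  | cfil_w w : cherednik_fil_set 0 (hw w)
  | cfil_x x : cherednik_fil_set 1 (hx x)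
  | cfil_y y : cherednik_fil_set 1 (hy y)
  | cfil_add i a b : cherednik_fil_set i a -> cherednik_fil_set i b ->
      cherednik_fil_set i (a + b)
  | cfil_mul i j a b : cherednik_fil_set i a -> cherednik_fil_set j b ->
      cherednik_fil_set (i + j) (a * b)
  | cfil_S i a : cherednik_fil_set i a -> cherednik_fil_set i.+1 a.

Lemma cfil_leq i j a :
  (i <= j)%N -> cherednik_fil_set i a -> cherednik_fil_set j a.
Proof.
move=> /subnKC <-; elim: (j - i)%N => [|k ih]; first by rewrite addn0.
by move=> /ih h; rewrite addnS; apply: cfil_S.
Qed.

Lemma cfil0 i : cherednik_fil_set i 0.
Proof. exact: (cfil_leq (leq0n i) (cfil_cst 0)). Qed.

Lemma cfilB i a b :
  cherednik_fil_set i a -> cherednik_fil_set i b -> cherednik_fil_set i (a - b).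
Proof.
move=> ha hb; apply: cfil_add => //.
exact: (cfil_mul (cfil_cst (-1)) hb).
Qed.

Lemma cfil_exhaustive a : exists i, cherednik_fil_set i a.
Proof.
elim/quotW: a; elim=> [k|x|y|w|a [i ha] b [j hb]|a [i ha] b [j hb]].
- by exists 0%N; apply: cfil_cst.
- by exists 1%N; apply: cfil_x.
- by exists 1%N; apply: cfil_y.
- by exists 0%N; apply: cfil_w.
- exists (maxn i j); rewrite pi_hadd; apply: cfil_add.
    by apply: cfil_leq ha; apply: leq_maxl.
  by apply: cfil_leq hb; apply: leq_maxr.
- by exists (i + j)%N; rewrite pi_hmul; apply: cfil_mul.
Qed.

Definition cherednik_fil : ring_filtration cherednik :=
  @RingFiltration cherednik cherednik_fil_set cfil0 cfilB (cfil_cst 1)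
    cfil_mul cfil_S cfil_exhaustive.

Local Notation gr := (gr_ring cherednik_fil).

Definition gr_cst (k : R[i]) : gr :=
  symb (G := reg_filtration cherednik_fil) (cfil_cst k).
Definition gr_x (x : 'rV[R[i]]_n) : gr :=
  symb (G := reg_filtration cherednik_fil) (cfil_x x).
Definition gr_y (y : 'cV[R[i]]_n) : gr :=
  symb (G := reg_filtration cherednik_fil) (cfil_y y).

(* C[h + h^* ] is the polynomial ring in n + n variables: the first n are the
   coordinates on h (the standard basis of h^* ), the last n the coordinates on
   h^* (the standard basis of h). *)
Definition gr_coord (i : 'I_(n + n)) : gr :=
  match split i with
  | inl j => gr_x (delta_mx 0 j)
  | inr j => gr_y (delta_mx j 0)
  end.

Definition coords (p : 'cV[R[i]]_n * 'rV[R[i]]_n) (i : 'I_(n + n)) : R[i] :=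
  match split i with
  | inl j => p.1 j 0
  | inr j => p.2 0 j
  end.

(* the canonical map C[h + h^* ] -> gr H *)
Definition gr_poly (f : {mpoly R[i][n + n]}) : gr :=
  \sum_(m <- msupp f) gr_cst f@_m * \prod_(i < n + n) gr_coord i ^+ m i.

Variable M : lmodType cherednik.

(* the support of gr M over C[h + h^* ]: the localization at the maximal ideal
   of p is nonzero if and only if some u is killed by no f with f(p) != 0 *)
Definition gr_supp (G : mod_filtration cherednik_fil M) :
    set ('cV[R[i]]_n * 'rV[R[i]]_n) :=
  [set p | exists u : graded G,
     forall f, gr_poly f *: u = 0 -> f.@[coords p] = 0].

(* the subalgebra C[h^* ] generated by h *)
Inductive poly_y : set cherednik :=
  | poly_y_cst k : poly_y (hcst k)
  | poly_y_gen y : poly_y (hy y)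
  | poly_y_add a b : poly_y a -> poly_y b -> poly_y (a + b)
  | poly_y_mul a b : poly_y a -> poly_y b -> poly_y (a * b).

Definition invariant_poly_y : set cherednik :=
  [set a | poly_y a /\ forall w, hw w * a * hw w^-1%g = a].

Definition locally_finite (D : set cherednik) : Prop :=
  forall m : M, exists e : seq M, forall a, D a ->
    exists k : nat -> R[i], a *: m = \sum_(i < size e) hcst (k i) *: e`_i.

Definition category_O : Prop := fin_gen M /\ locally_finite invariant_poly_y.

End Cherednik.

(* Main.v *)
Require Import Defs.
From mathcomp Require Import ssrcomplements mpoly.
From mathcomp Require Import all_boot all_order all_algebra all_fingroup.
From mathcomp Require Import generic_quotient mxrepresentation ring zify.
From mathcomp Require Import boolp classical_sets reals complex.

(* Let J be the annihilator of M in C[h].  Among the subsets T of S choose a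
   minimal one such that the product d of the roots outside T is not nilpotent
   modulo J; by minimality the roots in T are nilpotent modulo the localization
   J[1/d].  For y in the flat h_T (the common kernel of the roots in T), the
   operator d y, corrected by reflections outside T, has commutator d D_y f with
   every f in C[h], D_y being the derivative along y; so J[1/d] is stable under
   D_y.  Being proper, it then has radical equal to the
   ideal of h_T; in particular J vanishes on W h_T.
   Conversely a W-invariant f commutes with y up to D_y f, so the f-power-torsion
   of the simple module M is 0 or M: W-invariant polynomials vanishing on h_T,
   e.g. the products over the orbit of a linear form, are locally nilpotent on M.
   Since M is locally finite over C[h^* ], it is generated over C[h] by a finite
   dimensional subspace V stable under h and W, and filtering M by degree in
   C[h] starting from V computes the support: the y's are nilpotent on gr M, and
   by a Cayley-Hamilton argument a homogeneous polynomial that lowers the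
   filtration degree has a power that is the leading term of an element of J. *)

Set Implicit Arguments.
Unset Strict Implicit.
Unset Printing Implicit Defensive.

Import Order.TTheory GRing.Theory Num.Theory.
Local Open Scope ring_scope.

(** * Evaluation of polynomials at commuting elements of a ring *)

Lemma mpoly_ring_ind (C : comNzRingType) n (P : {mpoly C[n]} -> Prop) :
  (forall c, P c%:MP) -> (forall i, P 'X_i) ->
  (forall f g, P f -> P g -> P (f + g)) ->
  (forall f g, P f -> P g -> P (f * g)) ->
  forall f, P f.
Proof.
move=> PC PX PD PM; have PE f k : P f -> P (f ^+ k).
  move=> Pf; elim: k => [|k ih]; first by rewrite expr0 -mpolyC1.
  by rewrite exprS; apply: (PM).
elim/mpolyind => [|c m p _ _ ih]; first by rewrite -mpolyC0.
apply: (PD) => //; rewrite -mul_mpolyC; apply: (PM) => //.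
rewrite mpolyXE_id; elim/big_ind: _ => [|f g|i _]; [|exact: PM|exact: PE].
by rewrite -mpolyC1.
Qed.

(* [mmap] requires its target to be a non-trivial ring, which the Cherednik
   algebra and its associated graded ring are not known to be. *)
Section Evaluation.
Variables (C : comNzRingType) (n : nat) (A : pzRingType).
Variables (k : C -> A) (z : 'I_n -> A).
Hypothesis kD : forall a b, k (a + b) = k a + k b.
Hypothesis kM : forall a b, k (a * b) = k a * k b.
Hypothesis k1 : k 1 = 1.
Hypothesis kC : forall a b, k a * b = b * k a.
Hypothesis zC : forall i j, z i * z j = z j * z i.

Definition mev (f : {mpoly C[n]}) : A :=
  \sum_(m <- msupp f) k f@_m * \prod_(i < n) z i ^+ m i.

Lemma cst_morph0 : k 0 = 0.
Proof. by apply: (@addrI _ (k 0)); rewrite -kD !addr0. Qed.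

(** Gives polynomials with different supports a common finite index set, so that their values can be
    compared term by term. *)
Lemma mevwE (b : nat) f : (msize f <= b)%N ->
  mev f = \sum_(m : 'X_{1..n < b}) k f@_m * \prod_(i < n) z i ^+ (bmnm m) i.
Proof.
move=> le_fb; pose I : subFinType _ := 'X_{1..n < b}.
rewrite /mev (big_mksub I) ?msupp_uniq //=; first last.
  by move=> x /msize_mdeg_lt /leq_trans; apply.
rewrite big_rmcond //= => j /memN_msupp_eq0 ->.
by rewrite cst_morph0 mul0r.
Qed.

Lemma mevD : {morph mev : f g / f + g}.
Proof.
move=> f g; pose b := maxn (msize f) (msize g).
rewrite (@mevwE b) ?msizeD_le // (@mevwE b f) ?leq_maxl //.
rewrite (@mevwE b g) ?leq_maxr // -big_split /=; apply: eq_bigr => m _.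
by rewrite mcoeffD kD mulrDl.
Qed.

Lemma mev0 : mev 0 = 0.
Proof. by rewrite /mev msupp0 big_nil. Qed.

Lemma mev_sum (I : Type) (r : seq I) (P : pred I) (F : I -> {mpoly C[n]}) :
  mev (\sum_(i <- r | P i) F i) = \sum_(i <- r | P i) mev (F i).
Proof. exact: (big_morph mev mevD mev0). Qed.

Lemma mevZ c f : mev (c *: f) = k c * mev f.
Proof.
rewrite (@mevwE (msize f)) ?msizeZ_le // (@mevwE (msize f) f) // mulr_sumr.
by apply: eq_bigr => m _; rewrite mcoeffZ kM mulrA.
Qed.

Lemma mevXm m : mev 'X_[m] = \prod_(i < n) z i ^+ m i.
Proof. by rewrite /mev msuppX big_seq1 mcoeffX eqxx k1 mul1r. Qed.

Lemma mev1 : mev 1 = 1.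
Proof.
by rewrite -mpolyX0 mevXm big1 // => i _; rewrite mnm0E expr0.
Qed.

Lemma mevC c : mev c%:MP = k c.
Proof. by rewrite -[c%:MP]mulr1 mul_mpolyC mevZ mev1 mulr1. Qed.

Lemma mevX i : mev 'X_i = z i.
Proof.
rewrite mevXm -[RHS]mulr1.
(* The target ring need not be commutative, so the factor at [i] is isolated by splitting the index
   list around [i]. *)
have [s1 [s2 [-> n1 n2]]] : exists s1 s2, [/\ index_enum 'I_n = s1 ++ i :: s2,
    i \notin s1 & i \notin s2].
  have iE := mem_index_enum i; have := index_enum_uniq 'I_n.
  case/splitPr: iE => s1 s2; rewrite cat_uniq /= negb_or.
  by case/and4P => _ /andP[? _] ? _; exists s1, s2.
rewrite big_cat big_cons /= mnm1E eqxx expr1.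
rewrite [X in X * _]big_seq big1 ?mul1r; last first.
  move=> j js; rewrite mnm1E; case: eqP => [ij|_]; last by rewrite expr0.
  by move: n1; rewrite ij js.
congr (_ * _); rewrite big_seq big1 // => j js.
rewrite mnm1E; case: eqP => [ij|_]; last by rewrite expr0.
by move: n2; rewrite ij js.
Qed.

Lemma mevXM m1 m2 : mev 'X_[m1 + m2] = mev 'X_[m1] * mev 'X_[m2].
Proof.
rewrite !mevXm; elim: (index_enum _) => [|i r ih].
  by rewrite !big_nil mulr1.
rewrite !big_cons ih mnmDE exprD -!mulrA; congr (_ * _).
rewrite !mulrA; congr (_ * _); apply/esym/commrX/esym.
by apply: commr_prod => j _; apply: commrX; apply: zC.
Qed.

Lemma mevM : {morph mev : f g / f * g}.
Proof.
move=> f; elim/mpolyind => [|c m g _ _ ih]; first by rewrite !(mulr0, mev0).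
rewrite mulrDr !mevD mulrDr ih; congr (_ + _).
rewrite -scalerAr !mevZ mulrA -kC -mulrA; congr (_ * _) => {ih g}.
elim/mpolyind: f => [|d m' f _ _ ih]; first by rewrite !(mul0r, mev0).
rewrite mulrDl !mevD mulrDl ih; congr (_ + _).
by rewrite -scalerAl !mevZ -mulrA -mpolyXD mevXM.
Qed.

Lemma mevXn f j : mev (f ^+ j) = mev f ^+ j.
Proof.
by elim: j => [|j ih]; rewrite ?expr0 ?mev1 // !exprS mevM ih.
Qed.

Lemma mevN f : mev (- f) = - mev f.
Proof. by apply/eqP; rewrite -addr_eq0 -mevD addNr mev0. Qed.

Lemma mevB f g : mev (f - g) = mev f - mev g.
Proof. by rewrite mevD mevN. Qed.

Lemma mev_commC f g : mev f * mev g = mev g * mev f.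
Proof. by rewrite -!mevM mulrC. Qed.

Lemma mev_comm a : (forall i, a * z i = z i * a) ->
  forall f, a * mev f = mev f * a.
Proof.
move=> az; elim/mpoly_ring_ind => [c|i|f g ihf ihg|f g ihf ihg].
- by rewrite mevC kC.
- by rewrite mevX az.
- by rewrite mevD mulrDr mulrDl ihf ihg.
- by rewrite mevM mulrA ihf -mulrA ihg mulrA.
Qed.

End Evaluation.

Lemma eq_mev (C : comNzRingType) n (A : pzRingType) (k : C -> A) z z' :
  z =1 z' -> @mev C n A k z =1 mev k z'.
Proof.
move=> zz f; apply: eq_bigr => m _; congr (_ * _).
by apply: eq_bigr => i _; rewrite zz.
Qed.

Lemma mev_comp (C : comNzRingType) n n' (A : pzRingType) (k : C -> A) (z : 'I_n -> A)
    (kD : forall a b, k (a + b) = k a + k b)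
    (kM : forall a b, k (a * b) = k a * k b) (k1 : k 1 = 1)
    (kC : forall a b, k a * b = b * k a)
    (zC : forall i j, z i * z j = z j * z i)
    (t : n'.-tuple {mpoly C[n]}) f :
  mev k z (f \mPo t) = mev k (fun i => mev k z (tnth t i)) f.
Proof.
have tC i j : mev k z (tnth t i) * mev k z (tnth t j) =
    mev k z (tnth t j) * mev k z (tnth t i) by apply: mev_commC.
elim/mpoly_ring_ind: f => [c|i|f g ihf ihg|f g ihf ihg].
- by rewrite comp_mpolyC !mevC.
- by rewrite comp_mpolyXU -tnth_nth mevX.
- by rewrite comp_mpolyD !mevD // ihf ihg.
- by rewrite rmorphM !mevM //= ihf ihg.
Qed.

Lemma comp_mpolyM (C : comNzRingType) n k (t : n.-tuple {mpoly C[k]}) f g :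
  (f * g) \mPo t = (f \mPo t) * (g \mPo t).
Proof. exact: rmorphM. Qed.

Lemma comp_mpoly_comp (C : comNzRingType) n k l (t : n.-tuple {mpoly C[k]})
    (t' : k.-tuple {mpoly C[l]}) f :
  (f \mPo t) \mPo t' = f \mPo [tuple (tnth t i) \mPo t' | i < n].
Proof.
elim/mpoly_ring_ind: f => [c|i|f g ihf ihg|f g ihf ihg].
- by rewrite !comp_mpolyC.
- by rewrite !comp_mpolyXU -!tnth_nth [RHS]tnth_mktuple.
- by rewrite [f + g \mPo t]comp_mpolyD comp_mpolyD ihf ihg comp_mpolyD.
- by rewrite [f * g \mPo t]comp_mpolyM comp_mpolyM ihf ihg comp_mpolyM.
Qed.

(** * Linear forms, linear substitutions and directional derivatives *)

Section LinearSubstitution.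
Variables (C : comNzRingType) (n : nat).
Implicit Types (f g : {mpoly C[n]}) (X : 'M[C]_n) (x : 'rV[C]_n) (y : 'cV[C]_n).

Definition lin x : {mpoly C[n]} := \sum_j x 0 j *: 'X_j.

Lemma linD x x' : lin (x + x') = lin x + lin x'.
Proof. by rewrite -big_split; apply: eq_bigr => j _; rewrite mxE scalerDl. Qed.

Lemma linZ a x : lin (a *: x) = a *: lin x.
Proof. by rewrite scaler_sumr; apply: eq_bigr => j _; rewrite mxE scalerA. Qed.

Lemma lin0 : lin 0 = 0.
Proof. by rewrite /lin big1 // => j _; rewrite mxE scale0r. Qed.

Lemma lin_sum (I : Type) (r : seq I) (P : pred I) (F : I -> 'rV[C]_n) :
  lin (\sum_(i <- r | P i) F i) = \sum_(i <- r | P i) lin (F i).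
Proof. exact: (big_morph lin linD lin0). Qed.

Lemma lin_delta j : lin (delta_mx 0 j) = 'X_j.
Proof.
rewrite /lin (bigD1 j) //= mxE !eqxx scale1r big1 ?addr0 // => i ij.
by rewrite mxE (negPf ij) andbF scale0r.
Qed.

Lemma lin_homog x : lin x \is 1.-homog.
Proof.
apply: rpred_sum => j _; apply: rpredZ.
by rewrite dhomogX /= mdeg1.
Qed.

Lemma meval_lin x y : (lin x).@[fun i => y i 0] = (x *m y) 0 0.
Proof.
rewrite /lin rmorph_sum mxE /=; apply: eq_bigr => j _.
by rewrite mevalZ mevalXU.
Qed.

(** Pullback of [f] along the linear map [X]; being contravariant, it reverses products in
    [sub_lin_mul]. *)
Definition sub_lin X f : {mpoly C[n]} := f \mPo [tuple lin (row i X) | i < n].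

Lemma sub_linX X i : sub_lin X 'X_i = lin (row i X).
Proof. by rewrite /sub_lin comp_mpolyXU -tnth_nth tnth_mktuple. Qed.

Lemma sub_linC X c : sub_lin X c%:MP = c%:MP.
Proof. exact: comp_mpolyC. Qed.

Lemma sub_linD X f g : sub_lin X (f + g) = sub_lin X f + sub_lin X g.
Proof. exact: comp_mpolyD. Qed.

Lemma sub_linZ X c f : sub_lin X (c *: f) = c *: sub_lin X f.
Proof. exact: comp_mpolyZ. Qed.

Lemma sub_linM X f g : sub_lin X (f * g) = sub_lin X f * sub_lin X g.
Proof. exact: rmorphM. Qed.

Lemma sub_lin_lin X x : sub_lin X (lin x) = lin (x *m X).
Proof.
rewrite /sub_lin /lin raddf_sum /= -/(lin _).
transitivity (\sum_i x 0 i *: lin (row i X)).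
  by apply: eq_bigr => i _; rewrite comp_mpolyZ -sub_linX.
rewrite mulmx_sum_row -/(lin _) lin_sum.
by apply: eq_bigr => i _; rewrite linZ.
Qed.

Lemma sub_lin_mul X Y f : sub_lin X (sub_lin Y f) = sub_lin (Y *m X) f.
Proof.
elim/mpoly_ring_ind: f => [c|i|f g ihf ihg|f g ihf ihg].
- by rewrite !sub_linC.
- by rewrite !sub_linX sub_lin_lin row_mul.
- by rewrite !sub_linD ihf ihg.
- by rewrite !sub_linM ihf ihg.
Qed.

Lemma sub_lin1 f : sub_lin 1%:M f = f.
Proof.
elim/mpoly_ring_ind: f => [c|i|f g ihf ihg|f g ihf ihg].
- by rewrite !sub_linC.
- by rewrite !sub_linX row1 lin_delta.
- by rewrite !sub_linD ihf ihg.
- by rewrite !sub_linM ihf ihg.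
Qed.

Lemma meval_sub_lin X f y :
  (sub_lin X f).@[fun i => y i 0] = f.@[fun i => (X *m y) i 0].
Proof.
rewrite /sub_lin comp_mpoly_meval; apply: meval_eq => i.
by rewrite tnth_mktuple meval_lin -row_mul mxE.
Qed.

Definition dd y f : {mpoly C[n]} := \sum_j y j 0 *: mderiv j f.

Lemma ddD y f g : dd y (f + g) = dd y f + dd y g.
Proof.
by rewrite -big_split; apply: eq_bigr => j _; rewrite mderivD scalerDr.
Qed.

Lemma ddM y f g : dd y (f * g) = dd y f * g + f * dd y g.
Proof.
rewrite mulr_suml mulr_sumr -big_split; apply: eq_bigr => j _ /=.
by rewrite mderivM scalerDr scalerAl scalerAr.
Qed.

Lemma ddC y c : dd y c%:MP = 0.
Proof. by rewrite /dd big1 // => j _; rewrite mderivC scaler0. Qed.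

Lemma ddX y i : dd y 'X_i = (y i 0)%:MP.
Proof.
rewrite /dd (bigD1 i) //= big1 ?addr0 => [|j ji].
  rewrite mderivX mnm1E eqxx scale1r -[RHS]mulr1 mul_mpolyC -mpolyX0.
  by congr (_ *: 'X_[_]); apply/mnmP => j; rewrite mnmBE subnn mnm0E.
by rewrite mderivX mnm1E eq_sym (negPf ji) scale0r scaler0.
Qed.

Lemma dd_lin y x : dd y (lin x) = ((x *m y) 0 0)%:MP.
Proof.
rewrite mxE raddf_sum /=.
have ddZ a f : dd y (a *: f) = a *: dd y f.
  by rewrite -mul_mpolyC ddM ddC mul0r add0r mul_mpolyC.
have dd_0 : dd y 0 = 0 by rewrite -mpolyC0 ddC.
rewrite (big_morph _ (ddD y) dd_0).
by apply: eq_bigr => j _; rewrite ddZ ddX -mul_mpolyC mpolyCM.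
Qed.

(** Chain rule for a linear map. *)
Lemma dd_sub_lin X y f : dd y (sub_lin X f) = sub_lin X (dd (X *m y) f).
Proof.
elim/mpoly_ring_ind: f => [c|i|f g ihf ihg|f g ihf ihg].
- by rewrite sub_linC !ddC -mpolyC0 sub_linC.
- by rewrite sub_linX ddX sub_linC dd_lin -row_mul mxE.
- by rewrite !(sub_linD, ddD) ihf ihg.
- by rewrite !(sub_linM, ddM, sub_linD) ihf ihg.
Qed.

Lemma ddXn y f k : dd y (f ^+ k.+1) = (f ^+ k * dd y f) *+ k.+1.
Proof.
elim: k => [|k ih]; first by rewrite expr0 mul1r.
rewrite exprS ddM ih [in RHS]mulrS mulrC; congr (_ + _).
by rewrite mulrnAr mulrA -exprS.
Qed.

Lemma msize_mderiv i f : (msize (mderiv i f) <= (msize f).-1)%N.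
Proof.
rewrite [X in (X <= _)%N]msizeE big_seq.
elim/big_ind: _ => [//|a b ha hb|m ms]; first by rewrite geq_max ha.
rewrite -ltnS; apply: leq_trans (leqSpred _).
have : (m + U_(i))%MM \in msupp f.
  rewrite mcoeff_msupp; apply: contraTneq ms => h.
  by rewrite mcoeff_msupp mcoeff_deriv h mul0rn eqxx.
by move=> /msize_mdeg_lt; rewrite mdegD mdeg1 addn1.
Qed.

Lemma msize_dd y f b : (msize f <= b.+1)%N -> (msize (dd y f) <= b)%N.
Proof.
move=> hf; rewrite /dd; elim/big_ind: _ => [|g h hg hh|j _].
- by rewrite msize0.
- by apply: leq_trans (msizeD_le _ _) _; rewrite geq_max hg.
apply: leq_trans (msizeZ_le _ _) (leq_trans (msize_mderiv _ _) _).
by case: (msize f) hf.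
Qed.

Section Radical.
Variable N : {mpoly C[n]} -> Prop.
Hypothesis N0 : N 0.
Hypothesis ND : forall f g, N f -> N g -> N (f + g).
Hypothesis NM : forall f g, N f -> N (g * f).

(** Used with [N] the radical of an annihilator: variables or linear forms that are nilpotent modulo
    the annihilator may be replaced by 0. *)
Lemma comp_mpoly_congr (t t' : n.-tuple {mpoly C[n]}) :
  (forall i, N (tnth t i - tnth t' i)) ->
  forall f, N ((f \mPo t) - (f \mPo t')).
Proof.
move=> tt; elim/mpoly_ring_ind => [c|i|f g ihf ihg|f g ihf ihg].
- by rewrite !comp_mpolyC subrr; exact: N0.
- rewrite !comp_mpolyXU -!tnth_nth; exact: tt.
- by rewrite !comp_mpolyD opprD addrACA; exact: (ND).
- rewrite !rmorphM /=.
  set a := comp_mpoly t f; set b := comp_mpoly t g.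
  set a' := comp_mpoly t' f; set b' := comp_mpoly t' g.
  have -> : a * b - a' * b' = a * (b - b') + b' * (a - a').
    by rewrite !mulrBr [b' * a]mulrC [b' * a']mulrC subrKA.
  by apply: (ND); apply: (NM).
Qed.

Lemma sub_lin_congr X Y :
  (forall i, N (lin (row i (X - Y)))) -> forall f, N (sub_lin X f - sub_lin Y f).
Proof.
move=> h; apply: comp_mpoly_congr => i; rewrite !tnth_mktuple.
by have := h i; rewrite linearB linD -scaleN1r linZ scaleN1r.
Qed.

End Radical.

End LinearSubstitution.

(** In characteristic 0, a nonzero coefficient at a monomial containing the i-th variable survives
    in the i-th derivative. *)
Lemma mderiv_eq0_const (C : numDomainType) n (f : {mpoly C[n]}) :
  (forall i, mderiv i f = 0) -> f = (f@_0%MM)%:MP.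
Proof.
move=> h; apply/mpolyP => m; rewrite mcoeffC.
have [->|m0] := eqVneq m 0%MM; first by rewrite mulr1.
rewrite mulr0.
have [i mi] : exists i, m i != 0%N.
  apply/existsP; rewrite -[X in is_true X]negbK negb_exists.
  apply: contra m0 => /forallP mi; apply/eqP/mnmP => i.
  by apply/eqP; rewrite mnm0E -[_ == _]negbK mi.
have := congr1 (mcoeff (m - U_(i))%MM) (h i).
rewrite mcoeff_deriv mcoeff0 submK ?lep1mP // => /eqP.
by rewrite mulrn_eq0 /= => /eqP.
Qed.

Lemma eq_mulmx_cV (K : pzRingType) m n (X Y : 'M[K]_(m, n)) :
  (forall u : 'cV_n, X *m u = Y *m u) -> X = Y.
Proof.
move=> h; apply/matrixP => i j.
by have := congr1 (fun Z : 'cV_m => Z i 0) (h (delta_mx j 0)); rewrite -!colE !mxE.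
Qed.

Lemma lin_eq0 (K : comNzRingType) n (a : 'rV[K]_n) : lin a = 0 -> a = 0.
Proof.
move=> a0; apply: eq_mulmx_cV => y; apply/matrixP => i j.
by rewrite !ord1 -meval_lin a0 meval0 mul0mx mxE.
Qed.

(** * Reflections, roots and coroots after complexification *)

Section ComplexifiedReflections.
Variables (R : realType) (n : nat) (B : 'M[R]_n).
Local Notation cplx := (map_mx (real_complex R)).

(** A nonzero vector in the kernel of [B] would have norm 0. *)
Lemma gram_unit : is_gram B -> B \in unitmx.
Proof.
move=> [_ Bpos]; rewrite -row_free_unit -kermx_eq0; apply/eqP/row_matrixP => i.
rewrite row0; apply: contrapT => /eqP u0.
have kB : row i (kermx B) *m B = 0 by rewrite -row_mul mulmx_ker row0.
have := Bpos (row i (kermx B))^T; rewrite trmxK kB mul0mx mxE ltxx.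
by rewrite -(inj_eq trmx_inj) trmxK trmx0 u0 => /(_ isT).
Qed.


(** A root vanishes on the hyperplane of its reflection, hence is a multiple [l] of the form [b]
    dual to the reflection vector. The coroot is the reflection vector up to a factor containing the
    inverse of [l], so the choice of [l] drops out of both identities. *)
Lemma reflection_act (W : finGroupType) (rho : mx_representation R [set: W]%G n)
    (s : W) (a : 'rV[R[i]]_n) :
  is_gram B -> is_reflection B (rho s) -> is_root rho s a ->
  cplx (rho s) = 1%:M - coroot B a *m a /\ (a *m coroot B a) 0 0 = 2.
Proof.
move=> gB [v v0 sE] [a0 aE]; have uB := gram_unit gB; have [Bs Bp] := gB.
set q := (v^T *m B *m v) 0 0; have q0 : 0 < q := Bp _ v0.
set BC := cplx B; set vC := cplx v; set b := vC^T *m BC.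
have uBC : BC \in unitmx by rewrite map_unitmx.
have BCs : BC^T = BC by rewrite /BC matrix.map_trmx Bs.
have qC0 : (real_complex R q) != 0 by rewrite fmorph_eq0 gt_eqF.
have bv : (b *m vC) 0 0 = real_complex R q.
  by rewrite /b /vC /BC matrix.map_trmx -!map_mxM mxE.
have rE : rho s = 1%:M - (2 / q) *: (v *m (v^T *m B)).
  apply: eq_mulmx_cV => u; rewrite sE mulmxBl mul1mx -scalemxAl -/q -!mulmxA.
  congr (_ - _); rewrite [X in _ = _ *: (v *m X)]mx11_scalar mul_mx_scalar scalerA.
  congr (_ *: _); rewrite mulrAC; congr (_ * _).
  rewrite -[in RHS](trmxK (v^T *m _)) [in RHS]mxE !trmx_mul trmxK Bs.
  by rewrite mulmxA.
have sC : cplx (rho s) = 1%:M - (2 / real_complex R q) *: (vC *m b).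
  rewrite rE map_mxB map_mx1 map_mxZ !map_mxM -matrix.map_trmx; congr (_ - _ *: _).
  by rewrite rmorphM fmorphV /= rmorph_nat.
pose l := (a *m vC) 0 0 / real_complex R q.
(* Any [y] is a multiple of [vC] plus a vector killed by [b]; the latter is fixed by [s], hence
   killed by [a]. *)
have aE' : a = l *: b.
  apply: eq_mulmx_cV => y; pose t := (b *m y) 0 0 / real_complex R q.
  have by' : b *m (y - t *: vC) = 0.
    apply/matrixP => i k; rewrite !ord1 mulmxBr -scalemxAr mxE [X in _ + X]mxE.
    by rewrite [X in _ - X]mxE bv mulfVK // subrr mxE.
  have := aE (y - t *: vC); rewrite /act_h sC mulmxBl mul1mx -scalemxAl.
  rewrite -mulmxA by' mulmx0 scaler0 subr0 => /(_ erefl); rewrite /pairing.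
  rewrite mulmxBr -scalemxAr mxE [X in _ + X]mxE [X in _ - X]mxE => /eqP.
  rewrite subr_eq0 => /eqP ay; apply/matrixP => i k; rewrite !ord1 ay.
  by rewrite -scalemxAl [in RHS]mxE /l /t mulrC mulrAC mulrA.
have l0 : l != 0 by apply: contra_neq a0 => l0; rewrite aE' l0 scale0r.
have B'b : invmx BC *m b^T = vC by rewrite /b trmx_mul trmxK BCs mulKmx.
have aBa : (a *m invmx BC *m a^T) 0 0 = l * l * real_complex R q.
  rewrite aE' linearZ /= -!(scalemxAl, scalemxAr) -mulmxA B'b 2!mxE.
  by rewrite mulrA bv.
have coE : coroot B a = (2 / (l * real_complex R q)) *: vC.
  rewrite /coroot aBa aE' linearZ /= -scalemxAr B'b scalerA; congr (_ *: _).
  by rewrite -/BC; field; rewrite l0 qC0.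
rewrite coE; split.
  rewrite sC [in RHS]aE' -!(scalemxAl, scalemxAr) scalerA; congr (_ - _ *: _).
  by field; rewrite l0 qC0.
rewrite -scalemxAr mxE [X in _ * X](_ : _ = l * real_complex R q).
  by field; rewrite l0 qC0.
by rewrite {1}aE' -scalemxAl mxE bv.
Qed.

End ComplexifiedReflections.

Fact poly_eval_key : unit. Proof. by []. Qed.

(** * Relations in the Cherednik algebra, and its polynomial subalgebras *)

Section CherednikRelations.
Variables (R : realType) (n : nat) (W : finGroupType).
Variables (rho : mx_representation R [set: W]%G n) (B : 'M[R]_n).
Variables (S : {set W}) (alpha : W -> 'rV[R[i]]_n) (c : W -> R[i]).
Local Notation H := (cherednik rho B S alpha c).
Local Notation hx := (@hx R n W rho B S alpha c).
Local Notation hy := (@hy R n W rho B S alpha c).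
Local Notation hw := (@hw R n W rho B S alpha c).
Local Notation hcst := (@hcst R n W rho B S alpha c).
Local Notation poly := {mpoly R[i][n]}.

Definition rhoC (w : W) : 'M[R[i]]_n := map_mx (real_complex R) (rho w).

Lemma rhoCM u w : rhoC (u * w) = rhoC u *m rhoC w.
Proof. by rewrite /rhoC repr_mxM ?inE // map_mxM. Qed.

Lemma rhoC1 : rhoC 1 = 1%:M.
Proof. by rewrite /rhoC repr_mx1 map_mx1. Qed.

Lemma rhoCV w : rhoC w *m rhoC w^-1 = 1%:M.
Proof. by rewrite -rhoCM mulgV rhoC1. Qed.

Lemma rhoVC w : rhoC w^-1 *m rhoC w = 1%:M.
Proof. by rewrite -rhoCM mulVg rhoC1. Qed.

Lemma cstD k l : hcst (k + l) = hcst k + hcst l.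
Proof. exact: hcstD. Qed.

Lemma cstM k l : hcst (k * l) = hcst k * hcst l.
Proof. exact: hcstM. Qed.

Lemma cst1 : hcst 1 = 1. Proof. by []. Qed.

Lemma cst0 : hcst 0 = 0. Proof. by []. Qed.

Lemma cstN k : hcst (- k) = - hcst k.
Proof. by apply/eqP; rewrite -addr_eq0 -cstD addNr. Qed.

Lemma cstC k (a : H) : hcst k * a = a * hcst k.
Proof. exact: hcstC. Qed.

Lemma hxD x x' : hx (x + x') = hx x + hx x'.
Proof. by rewrite -[RHS]pi_hadd; apply/cherednik_eqP/crel_XD. Qed.

Lemma hxZ k x : hx (k *: x) = hcst k * hx x.
Proof. by rewrite -[RHS]pi_hmul; apply/cherednik_eqP/crel_XZ. Qed.

Lemma hyD y y' : hy (y + y') = hy y + hy y'.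
Proof. by rewrite -[RHS]pi_hadd; apply/cherednik_eqP/crel_YD. Qed.

Lemma hyZ k y : hy (k *: y) = hcst k * hy y.
Proof. by rewrite -[RHS]pi_hmul; apply/cherednik_eqP/crel_YZ. Qed.

Lemma hx0 : hx 0 = 0.
Proof. by rewrite -(scale0r 0) hxZ cst0 mul0r. Qed.

Lemma hy0 : hy 0 = 0.
Proof. by rewrite -(scale0r 0) hyZ cst0 mul0r. Qed.

Lemma hw1 : hw 1 = 1.
Proof. exact/cherednik_eqP/crel_W1. Qed.

Lemma hwM u w : hw (u * w) = hw u * hw w.
Proof. by rewrite -[RHS]pi_hmul; apply/cherednik_eqP/crel_WM. Qed.

Lemma hwV w : hw w^-1 * hw w = 1.
Proof. by rewrite -hwM mulVg hw1. Qed.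

Lemma hwx w x : hw w * hx x = hx (x *m rhoC w^-1) * hw w.
Proof.
have <- : hw w * hx x * hw w^-1 = hx (x *m rhoC w^-1).
  rewrite -[hw w * hx x]pi_hmul -[LHS]pi_hmul.
  exact/cherednik_eqP/crel_WX.
by rewrite -mulrA hwV mulr1.
Qed.

Lemma hwy w y : hw w * hy y = hy (rhoC w *m y) * hw w.
Proof.
have <- : hw w * hy y * hw w^-1 = hy (rhoC w *m y).
  rewrite -[hw w * hy y]pi_hmul -[LHS]pi_hmul.
  exact/cherednik_eqP/crel_WY.
by rewrite -mulrA hwV mulr1.
Qed.

Lemma hxC x x' : hx x * hx x' = hx x' * hx x.
Proof. by rewrite -[LHS]pi_hmul -[RHS]pi_hmul; apply/cherednik_eqP/crel_XX. Qed.

Lemma hyC y y' : hy y * hy y' = hy y' * hy y.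
Proof. by rewrite -[LHS]pi_hmul -[RHS]pi_hmul; apply/cherednik_eqP/crel_YY. Qed.

(* Locked so that sums in [poly] and in [H] are not confused by unification. *)
Definition px (f : poly) : H :=
  locked_with poly_eval_key (mev hcst (fun i => hx (delta_mx 0 i)) f).
Definition py (f : poly) : H :=
  locked_with poly_eval_key (mev hcst (fun i => hy (delta_mx i 0)) f).

Lemma pxE f : px f = mev hcst (fun i => hx (delta_mx 0 i)) f.
Proof. by rewrite /px unlock. Qed.
Lemma pyE f : py f = mev hcst (fun i => hy (delta_mx i 0)) f.
Proof. by rewrite /py unlock. Qed.

Let px_C i j : hx (delta_mx 0 i) * hx (delta_mx 0 j) = hx (delta_mx 0 j) * hx (delta_mx 0 i).
Proof. exact: hxC. Qed.
Let py_C i j : hy (delta_mx i 0) * hy (delta_mx j 0) = hy (delta_mx j 0) * hy (delta_mx i 0).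
Proof. exact: hyC. Qed.

Lemma pxD f g : px (f + g) = px f + px g. Proof. rewrite !pxE; exact: (mevD _ cstD). Qed.
Lemma pxB f g : px (f - g) = px f - px g. Proof. rewrite !pxE; exact: (mevB _ cstD). Qed.
Lemma px0 : px 0 = 0. Proof. rewrite !pxE; exact: mev0. Qed.
Lemma px1 : px 1 = 1. Proof. rewrite !pxE; exact: (mev1 _ cst1). Qed.
Lemma pxM f g : px (f * g) = px f * px g.
Proof. rewrite !pxE; exact: (mevM cstD cstM cst1 cstC px_C). Qed.
Lemma pxC k : px k%:MP = hcst k. Proof. rewrite !pxE; exact: (mevC _ cstD cstM cst1). Qed.
Lemma pxX i : px 'X_i = hx (delta_mx 0 i). Proof. rewrite !pxE; exact: (mevX _ cst1). Qed.
Lemma pxZ k f : px (k *: f) = hcst k * px f.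
Proof. rewrite !pxE; exact: (mevZ _ cstD cstM). Qed.
Lemma px_commC f g : px f * px g = px g * px f.
Proof. by rewrite -!pxM mulrC. Qed.
Lemma px_sum (I : Type) (r : seq I) (P : pred I) (F : I -> poly) :
  px (\sum_(i <- r | P i) F i) = \sum_(i <- r | P i) px (F i).
Proof. exact: (big_morph px pxD px0). Qed.

Lemma pyD f g : py (f + g) = py f + py g. Proof. rewrite !pyE; exact: (mevD _ cstD). Qed.
Lemma py0 : py 0 = 0. Proof. rewrite !pyE; exact: mev0. Qed.
Lemma py1 : py 1 = 1. Proof. rewrite !pyE; exact: (mev1 _ cst1). Qed.
Lemma pyM f g : py (f * g) = py f * py g.
Proof. rewrite !pyE; exact: (mevM cstD cstM cst1 cstC py_C). Qed.
Lemma pyC k : py k%:MP = hcst k. Proof. rewrite !pyE; exact: (mevC _ cstD cstM cst1). Qed.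
Lemma pyX i : py 'X_i = hy (delta_mx i 0). Proof. rewrite !pyE; exact: (mevX _ cst1). Qed.
Lemma py_sum (I : Type) (r : seq I) (P : pred I) (F : I -> poly) :
  py (\sum_(i <- r | P i) F i) = \sum_(i <- r | P i) py (F i).
Proof. exact: (big_morph py pyD py0). Qed.

Lemma px_lin x : px (lin x) = hx x.
Proof.
rewrite px_sum [in RHS](row_sum_delta x) (big_morph hx hxD hx0).
by apply: eq_bigr => j _; rewrite pxZ pxX hxZ.
Qed.

Lemma py_lin x : py (lin x) = hy x^T.
Proof.
rewrite py_sum [in RHS](row_sum_delta x) linear_sum (big_morph hy hyD hy0).
apply: eq_bigr => j _.
by rewrite -mul_mpolyC pyM pyC pyX linearZ /= trmx_delta hyZ.
Qed.

(** The actions of [w] on C[h] and, in [wy], on C[h^*]. The variables of the second ring are vectors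
    of h, which [rhoC w] multiplies from the left; hence the transpose there. *)
Definition wx (w : W) : poly -> poly := sub_lin (rhoC w^-1).
Definition wy (w : W) : poly -> poly := sub_lin (rhoC w)^T.

Lemma wxM u w f : wx u (wx w f) = wx (u * w) f.
Proof. by rewrite /wx sub_lin_mul invMg rhoCM. Qed.

Lemma wyM u w f : wy u (wy w f) = wy (u * w) f.
Proof. by rewrite /wy sub_lin_mul rhoCM trmx_mul. Qed.

Lemma wx1 f : wx 1 f = f.
Proof. by rewrite /wx invg1 rhoC1 sub_lin1. Qed.

Lemma wy1 f : wy 1 f = f.
Proof. by rewrite /wy rhoC1 trmx1 sub_lin1. Qed.

Lemma hw_px w f : hw w * px f = px (wx w f) * hw w.
Proof.
elim/mpoly_ring_ind: f => [k|i|f g ihf ihg|f g ihf ihg].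
- by rewrite /wx sub_linC !pxC cstC.
- by rewrite /wx sub_linX pxX hwx px_lin -rowE.
- by rewrite /wx sub_linD !pxD mulrDr mulrDl ihf ihg.
- by rewrite /wx sub_linM !pxM mulrA ihf -mulrA ihg mulrA.
Qed.

Lemma hw_py w f : hw w * py f = py (wy w f) * hw w.
Proof.
elim/mpoly_ring_ind: f => [k|i|f g ihf ihg|f g ihf ihg].
- by rewrite /wy sub_linC !pyC cstC.
- by rewrite /wy sub_linX pyX hwy py_lin tr_row trmxK -colE.
- by rewrite /wy sub_linD !pyD mulrDr mulrDl ihf ihg.
- by rewrite /wy sub_linM !pyM mulrA ihf -mulrA ihg mulrA.
Qed.

Hypothesis gramB : is_gram B.
Hypothesis reflS : forall s, s \in S -> is_reflection B (rho s).
Hypothesis rootS : forall s, s \in S -> is_root rho s (alpha s).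

Lemma rhoC_refl s : s \in S -> rhoC s = 1%:M - coroot B (alpha s) *m alpha s.
Proof. by move=> sS; case: (reflection_act gramB (reflS sS) (rootS sS)). Qed.

(** A reflection is an involution because its root takes the value 2 on its coroot. *)
Lemma rhoC_reflV s : s \in S -> rhoC s^-1 = rhoC s.
Proof.
move=> sS; have [_ ac] := reflection_act gramB (reflS sS) (rootS sS).
have ss : rhoC s *m rhoC s = 1%:M.
  rewrite (rhoC_refl sS) mulmxBl mul1mx mulmxBr mulmx1.
  rewrite -!mulmxA [alpha s *m (_ *m _)]mulmxA [alpha s *m coroot _ _]mx11_scalar.
  rewrite ac mul_scalar_mx -scalemxAr.
  by rewrite (scaler_nat 2) mulr2n opprB addrK subrK.
by rewrite -[LHS]mul1mx -ss -mulmxA rhoCV mulmx1.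
Qed.

Lemma hyx_act y x : hy y * hx x = hx x * hy y + hcst ((x *m y) 0 0) +
  \sum_(s in S) hcst (c s * (alpha s *m y) 0 0 * (x *m coroot B (alpha s)) 0 0) * hw s.
Proof. by rewrite -addrA -[X in _ = _ + X]hyx addrC subrK. Qed.

End CherednikRelations.

(** * Ideals and radicals *)

Section Ideals.
Variable A : comPzRingType.
Implicit Types (I : A -> Prop) (f g : A).

Definition is_ideal I : Prop :=
  [/\ I 0, forall f g, I f -> I g -> I (f + g) & forall f g, I f -> I (g * f)].

Definition radical I f : Prop := exists k, I (f ^+ k).

Lemma radical_ideal I : is_ideal I -> is_ideal (radical I).
Proof.
move=> [I0 ID IM]; split; first by exists 1%N; rewrite expr1.
  move=> f g [k hf] [l hg]; exists (k + l)%N; rewrite exprDn.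
  elim/big_ind: _ => // i _; rewrite -mulr_natr mulrC; apply: (IM).
  have [li|il] := leqP l i.
    by rewrite -(subnK li) exprD mulrA; apply: (IM).
  by rewrite -addnBA ?(ltnW il) // exprD -mulrA mulrC; apply: (IM).
by move=> f g [k hf]; exists k; rewrite exprMn; apply: IM.
Qed.

Lemma idealN I f : is_ideal I -> I f -> I (- f).
Proof. by move=> [_ _ IM] If; rewrite -mulN1r; apply: IM. Qed.

Lemma idealB I f g : is_ideal I -> I f -> I g -> I (f - g).
Proof. by move=> iI If Ig; have [_ ID _] := iI; apply: (ID _ _ If); apply: idealN. Qed.

Lemma ideal_sum I (J : Type) (r : seq J) (P : pred J) (F : J -> A) :
  is_ideal I -> (forall j, P j -> I (F j)) -> I (\sum_(j <- r | P j) F j).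
Proof. by move=> [I0 ID _] hF; elim/big_ind: _ => //; apply: (ID). Qed.

Lemma sub_radical I f : I f -> radical I f.
Proof. by exists 1%N; rewrite expr1. Qed.

End Ideals.

(** * Dunkl-type operators and the annihilator of M in C[h] *)

Section Localization.
Variables (R : realType) (n : nat) (W : finGroupType).
Variables (rho : mx_representation R [set: W]%G n) (B : 'M[R]_n).
Variables (S : {set W}) (alpha : W -> 'rV[R[i]]_n) (c : W -> R[i]).
Hypothesis gramB : is_gram B.
Hypothesis reflS : forall s, s \in S -> is_reflection B (rho s).
Hypothesis rootS : forall s, s \in S -> is_root rho s (alpha s).
Local Notation H := (cherednik rho B S alpha c).
Local Notation hx := (@hx R n W rho B S alpha c).
Local Notation hy := (@hy R n W rho B S alpha c).
Local Notation hw := (@hw R n W rho B S alpha c).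
Local Notation hcst := (@hcst R n W rho B S alpha c).
Local Notation px := (@px R n W rho B S alpha c).
Local Notation rhoC := (rhoC rho).
Local Notation wx := (wx rho).
Local Notation poly := {mpoly R[i][n]}.

Definition root_prod (T : {set W}) : poly := \prod_(s in T) lin (alpha s).

(** With d the product of the roots in [T], this is d times y plus the sum over s in [T] of c_s
    alpha_s(y) alpha_s^-1 s, with denominators cleared. As s x - x s is -<alpha_s^vee, x> alpha_s s,
    the correction cancels the terms with s in [T] in the commutator of y and x. *)
Definition dunkl (T : {set W}) (y : 'cV[R[i]]_n) : H :=
  px (root_prod T) * hy y +
  \sum_(s in T) px ((c s * (alpha s *m y) 0 0) *: root_prod (T :\ s)) * hw s.

Lemma lin_rhoV s x : s \in S ->
  lin (x *m rhoC s^-1) = lin x - (x *m coroot B (alpha s)) 0 0 *: lin (alpha s).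
Proof.
move=> sS; rewrite (rhoC_reflV gramB reflS rootS sS) (rhoC_refl gramB reflS rootS sS).
rewrite mulmxBr mulmx1 linD -scaleN1r linZ scaleN1r mulmxA; congr (_ - _).
by rewrite [X in lin (X *m _)]mx11_scalar mul_scalar_mx linZ.
Qed.

(* Multiplying the Dunkl-type operator by the product of the roots outside the
   stabilizer avoids localizing the Cherednik algebra. *)
Lemma dunkl_px (T : {set W}) y f : T \subset S ->
  (forall s, s \in S :\: T -> alpha s *m y = 0) ->
  dunkl T y * px f = px f * dunkl T y + px (root_prod T * dd y f).
Proof.
move=> TS yT; elim/mpoly_ring_ind: f => [k|i|f g ihf ihg|f g ihf ihg].
- by rewrite ddC mulr0 px0 addr0 pxC cstC.
- set x := delta_mx 0 i : 'rV[R[i]]_n.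
  have Xi : 'X_i = lin x by rewrite lin_delta.
  rewrite Xi dd_lin [in LHS]px_lin mulrDl -[px _ * hy y * _]mulrA hyx_act.

  rewrite (bigID (mem T)) /= [X in _ + (_ + X)]big1 ?addr0; last first.
    move=> s /andP[sS sT]; rewrite yT ?inE ?sT //.
    by rewrite mxE mulr0 mul0r cst0 mul0r.
  rewrite (eq_bigl (mem T)) => [|s]; last first.
    by apply/andb_idl => sT; apply: (fintype.subsetP TS).
  rewrite mulrDr mulrDr mulrA -px_lin px_commC -mulrA -!addrA.
  rewrite [in RHS]mulrDr -addrA; congr (_ + _).
  rewrite -pxC -pxM [RHS]addrC; congr (_ + _).
  rewrite mulr_suml !mulr_sumr -big_split; apply: eq_bigr => s sT.
  have sS : s \in S by apply: (fintype.subsetP TS).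
  rewrite -[px _ * hw s * _]mulrA px_lin hwx -px_lin (lin_rhoV _ sS).
  rewrite -px_lin -pxC !mulrA -!pxM -[LHS]mulrDl -pxD; congr (px _ * _).
  rewrite {1}/root_prod (big_setD1 s) //= -/(root_prod _).
  by rewrite -!mul_mpolyC !mpolyCM; ring.
- move: (dunkl T y) ihf ihg => E ihf ihg.
  by rewrite ddD mulrDr !pxD mulrDr mulrDl ihf ihg addrACA.
- move: (dunkl T y) ihf ihg => E ihf ihg.
  rewrite ddM [px (f * g)]pxM mulrA ihf mulrDl -mulrA ihg mulrDr !mulrA -!pxM -addrA -pxD.
  by congr (_ + px _); ring.
Qed.

(** [D s] is the divided difference (f - s f) / alpha_s. Its existence and the commutator formula
    are proved together by induction on f; for products, [D s] obeys the twisted Leibniz rule D(f g)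
    = f D(g) + D(f) s(g). *)
Lemma divided_differences y f : exists D : W -> poly,
  (forall s, s \in S -> lin (alpha s) * D s = f - wx s f) /\
  hy y * px f = px f * hy y + px (dd y f) +
    \sum_(s in S) px ((c s * (alpha s *m y) 0 0) *: D s) * hw s.
Proof.
elim/mpoly_ring_ind: f => [k|i|f g|f g].
- exists (fun=> 0); split => [s sS|]; first by rewrite mulr0 /wx sub_linC subrr.
  rewrite ddC px0 addr0 pxC cstC big1 ?addr0 // => s _.
  by rewrite scaler0 px0 mul0r.
- set x := delta_mx 0 i : 'rV[R[i]]_n.
  have Xi : 'X_i = lin x by rewrite lin_delta.
  exists (fun s => ((x *m coroot B (alpha s)) 0 0)%:MP); split => [s sS|].
    rewrite Xi /wx sub_lin_lin (lin_rhoV _ sS) opprB addrC subrK.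
    by rewrite mulrC mul_mpolyC.
  rewrite Xi dd_lin px_lin hyx_act pxC; congr (_ + _).
  by apply: eq_bigr => s _; rewrite -mul_mpolyC -mpolyCM pxC.
- move=> [D [hD eD]] [D' [hD' eD']]; exists (fun s => D s + D' s).
  split => [s sS|].
    by rewrite mulrDr hD // hD' // /wx sub_linD opprD addrACA.
  rewrite pxD mulrDr eD eD' ddD pxD mulrDl [LHS]addrACA [X in X + _ = _]addrACA.
  congr (_ + _); rewrite -big_split; apply: eq_bigr => s _ /=.
  by rewrite scalerDr pxD mulrDl.
- move=> [D [hD eD]] [D' [hD' eD']].
  exists (fun s => f * D' s + D s * wx s g); split => [s sS|].
    move: (hD s sS) (hD' s sS); rewrite [wx s (f * g)]sub_linM.
    rewrite -!/(wx s _).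
    move: (wx s f) (wx s g) (D s) (D' s) (lin _) => f' g' d d' l dE dE'.
    by rewrite mulrDr mulrCA dE' mulrA dE mulrBr mulrBl subrKA.
  pose S1 := \sum_(s in S) px ((c s * (alpha s *m y) 0 0) *: D s) * hw s.
  pose S2 := \sum_(s in S) px ((c s * (alpha s *m y) 0 0) *: D' s) * hw s.
  have <- : px f * S2 + S1 * px g =
    \sum_(s in S) px ((c s * (alpha s *m y) 0 0) *: (f * D' s + D s * wx s g)) * hw s.
    rewrite mulr_sumr mulr_suml -big_split; apply: eq_bigr => s _ /=.
    rewrite -[X in _ + X]mulrA hw_px !mulrA -!pxM -mulrDl -pxD; congr (px _ * _).
    by rewrite scalerDr scalerAr scalerAl.
  rewrite [px (f * g)]pxM mulrA eD -/S1 mulrDl mulrDl.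
  rewrite -[px f * _ * _]mulrA eD' -/S2 mulrDr mulrDr mulrA -!addrA.
  congr (_ + _); rewrite ddM pxD !pxM -!addrA.
  by rewrite [RHS]addrCA; congr (_ + _); rewrite addrCA.
Qed.

(** All divided differences of an invariant vanish, since alpha_s is nonzero and C[h] is a
    domain. *)
Lemma invariant_comm y f : (forall s, s \in S -> wx s f = f) ->
  hy y * px f = px f * hy y + px (dd y f).
Proof.
move=> fS; have [D [hD ->]] := divided_differences y f.
rewrite big1 ?addr0 // => s sS.
have /eqP := hD s sS; rewrite fS // subrr mulf_eq0 => /orP[/eqP l0|/eqP ->].
  by have [/negP[]] := rootS sS; apply/eqP/lin_eq0.
by rewrite scaler0 px0 mul0r.
Qed.


Variable M : lmodType H.

Lemma stable_set_submodule (N : set M) : N 0 ->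
  (forall u v, N u -> N v -> N (u + v)) ->
  (forall k u, N u -> N (hcst k *: u)) ->
  (forall x u, N u -> N (hx x *: u)) ->
  (forall y u, N u -> N (hy y *: u)) ->
  (forall w u, N u -> N (hw w *: u)) ->
  submodule N.
Proof.
move=> N0 ND Nc Nx Ny Nw; split=> // a; elim/quotW: a.
elim=> [k|x|y|w|a iha b ihb|a iha b ihb] u Nu.
- exact: Nc.
- exact: Nx.
- exact: Ny.
- exact: Nw.
- by have := ND _ _ (iha u Nu) (ihb u Nu); rewrite -scalerDl pi_hadd.
- by have := iha _ (ihb u Nu); rewrite scalerA pi_hmul.
Qed.

(** The ideal J of the overview. *)
Definition annx (f : poly) : Prop := forall m : M, px f *: m = 0.

Lemma annx_ideal : is_ideal annx.
Proof.
split=> [m|f g hf hg m|f g hf m]; first by rewrite px0 scale0r.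
  by rewrite pxD scalerDl hf hg addr0.
by rewrite pxM -scalerA hf scaler0.
Qed.

Lemma annx_wx w f : annx f -> annx (wx w f).
Proof.
move=> hf m; have -> : px (wx w f) = hw w * px f * hw w^-1.
  by rewrite hw_px -mulrA -hwM mulgV hw1 mulr1.
by rewrite -mulrA -scalerA -[_ *: m]scalerA hf scaler0.
Qed.

(* [T] is the set of roots being inverted. *)
Definition annx_loc (T : {set W}) (f : poly) : Prop :=
  exists k, annx (root_prod T ^+ k * f).

Lemma annx_loc_ideal T : is_ideal (annx_loc T).
Proof.
have [_ ID IM] := annx_ideal; split=> [|f g [k hf] [l hg]|f g [k hf]].
- by exists 0%N; rewrite mulr0; case: annx_ideal.
- exists (k + l)%N; rewrite exprD mulrDr; apply: (ID).
    by rewrite [X in X * f]mulrC -mulrA; apply: (IM).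
  by rewrite -mulrA; apply: (IM).
- by exists k; rewrite mulrCA; apply: (IM).
Qed.

(** Commuting [dunkl T y] past g in J shows that d D_y g is in J. For g = d^k f, the Leibniz rule
    yields d^(k+1) D_y f plus a multiple of d^k f, and the latter is already in J. *)
Lemma annx_loc_dd (T : {set W}) y f : T \subset S ->
  (forall s, s \in S :\: T -> alpha s *m y = 0) ->
  annx_loc T f -> annx_loc T (dd y f).
Proof.
move=> TS yT; have [_ _ IM] := annx_ideal.
have annx_dd g : annx g -> annx (root_prod T * dd y g).
  move=> hg m; have := dunkl_px g TS yT.
  move=> /(congr1 (fun a : H => a *: m)); rewrite scalerDl -!scalerA !hg.
  by rewrite scaler0 add0r.
case=> k hf; exists k.+1; set d := root_prod T in hf annx_dd *.
have := annx_dd _ hf; rewrite ddM mulrDr => h.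
have -> : d ^+ k.+1 * dd y f = d * (dd y (d ^+ k) * f) + d * (d ^+ k * dd y f)
    - (d * (dd y (d ^+ k) * f)) by rewrite [X in _ = X - _]addrC addrK exprS mulrA.
apply: (idealB annx_ideal) => //.
case: k hf {h} => [|k] hf m.
  by rewrite expr0 -mpolyC1 ddC mul0r mulr0 px0 scale0r.
rewrite ddXn; suff -> : d * (d ^+ k * dd y d *+ k.+1 * f) =
    (dd y d *+ k.+1) * (d ^+ k.+1 * f) by apply: IM.
by rewrite mulrnAl mulrnAr mulrnAl exprS; congr (_ *+ _); ring.
Qed.

End Localization.

(** * The flat attached to M *)

Section Flat.
Variables (R : realType) (n : nat) (W : finGroupType).
Variables (rho : mx_representation R [set: W]%G n) (B : 'M[R]_n).
Variables (S : {set W}) (alpha : W -> 'rV[R[i]]_n) (c : W -> R[i]).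
Hypothesis gramB : is_gram B.
Hypothesis reflS : forall s, s \in S -> is_reflection B (rho s).
Hypothesis rootS : forall s, s \in S -> is_root rho s (alpha s).
Local Notation H := (cherednik rho B S alpha c).
Local Notation px := (@px R n W rho B S alpha c).
Local Notation rhoC := (rhoC rho).
Local Notation wx := (wx rho).
Local Notation poly := {mpoly R[i][n]}.
Local Notation root_prod := (root_prod alpha).

(** The kernel of this matrix is the flat h_T. Rows outside [T] are zero, so that the format does
    not depend on [T]. *)
Definition root_mx (T : {set W}) : 'M[R[i]]_(#|W|, n) :=
  \matrix_(i < #|W|) (if enum_val i \in T then alpha (enum_val i) else 0).

(* a projection of h onto the intersection of the root hyperplanes of [T] *)
Definition flat_proj (T : {set W}) : 'M[R[i]]_n :=
  1%:M - pinvmx (root_mx T) *m root_mx T.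

Lemma root_mx_proj T : root_mx T *m flat_proj T = 0.
Proof. by rewrite mulmxBr mulmx1 mulmxA mulmxKpV // subrr. Qed.

Lemma row_root_mx T i :
  row i (root_mx T) = if enum_val i \in T then alpha (enum_val i) else 0.
Proof. exact: rowK. Qed.

Lemma root_mx_eq0 T m (Y : 'M_(n, m)) :
  root_mx T *m Y = 0 <-> forall s, s \in T -> alpha s *m Y = 0.
Proof.
split=> [h s sT|h].
  have := congr1 (row (enum_rank s)) h.
  by rewrite row_mul row_root_mx enum_rankK sT row0.
apply/row_matrixP => i; rewrite row_mul row_root_mx row0.
by case: ifP => [/h//|_]; rewrite mul0mx.
Qed.

Lemma root_proj (T : {set W}) s : s \in T -> alpha s *m flat_proj T = 0.
Proof. by move: s; apply/root_mx_eq0/root_mx_proj. Qed.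

Lemma flat_proj_id T m (Y : 'M_(n, m)) : root_mx T *m Y = 0 -> flat_proj T *m Y = Y.
Proof. by move=> h; rewrite mulmxBl mul1mx -mulmxA h mulmx0 subr0. Qed.

Lemma ideal_lin_root_mx (I : poly -> Prop) (T : {set W}) : is_ideal I ->
  (forall s, s \in T -> I (lin (alpha s))) ->
  forall x, I (lin (x *m root_mx T)).
Proof.
move=> iI h x; rewrite mulmx_sum_row lin_sum; apply: ideal_sum => // i _.
have [I0 _ IM] := iI.
rewrite row_root_mx linZ -mul_mpolyC; apply: (IM).
by case: ifP => [/h//|_]; rewrite lin0.
Qed.

Variable M : lmodType H.
Local Notation annx := (@annx R n W rho B S alpha c M).
Local Notation annx_loc := (@annx_loc R n W rho B S alpha c M).

(** With d the product of the roots outside [T]: J[1/d] is a proper ideal, and the roots in [T] are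
    nilpotent modulo it. The translates of h_T will turn out to form the support. *)
Definition is_support_flat (T : {set W}) : Prop :=
  [/\ T \subset S, forall k, ~ annx (root_prod (S :\: T) ^+ k)
    & forall s, s \in T -> radical (annx_loc (S :\: T)) (lin (alpha s))].

(** [T = S] has the non-nilpotency property, the product being empty and M nonzero; a minimal [T]
    with this property is taken. Dropping s from it makes d alpha_s nilpotent modulo J, which means
    that alpha_s is nilpotent modulo J[1/d]. *)
Lemma exists_support_flat : (exists m : M, m <> 0) -> exists T, is_support_flat T.
Proof.
move=> [m m0].
pose P (T : {set W}) := (T \subset S) && `[< forall k, ~ annx (root_prod (S :\: T) ^+ k) >].
have PS : P S.
  rewrite /P fintype.subxx; apply/asboolP => k.
  rewrite finset.setDv /root_prod big_set0 expr1n => /(_ m).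
  by rewrite px1 scale1r.
have [T /minsetP[/andP[TS /asboolP PT] Tmin] _] := minset_exists PS.
exists T; split=> // s sT.
have : ~~ P (T :\ s).
  apply/negP => /Tmin /(_ (subD1set _ _)) /setP/(_ s).
  by rewrite !inE eqxx sT.
rewrite negb_and (fintype.subset_trans (subD1set _ _) TS) /=.
move=> /asboolPn /existsNP[k /contrapT h]; exists k, k; move: h.
have -> : S :\: (T :\ s) = s |: (S :\: T).
  apply/setP => t; rewrite !inE negb_and negbK.
  by case: eqP => [->|] //=; rewrite (fintype.subsetP TS) ?sT.
rewrite /root_prod big_setU1 /=; last by rewrite !inE sT.
by rewrite exprMn mulrC.
Qed.

Variable T : {set W}.
Hypothesis Tflat : is_support_flat T.
Local Notation loc := (annx_loc (S :\: T)).
Local Notation pi := (flat_proj T).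

Lemma annx_loc_cst k : loc k%:MP -> k = 0.
Proof.
move=> [j hj]; apply: contrapT => /eqP k0; have [_ h _] := Tflat.
apply: (h j); have [_ _ IM] := annx_ideal M.
have := IM _ (k^-1%:MP) hj; rewrite mulrCA -mpolyCM mulVf //.
by rewrite mpolyC1 mulr1.
Qed.

(* By induction on the degree all derivatives of [f] along the flat vanish on
   it, so [f] is constant there; the constant is [f] modulo nilpotents. *)
Lemma annx_loc_vanish f : loc f -> sub_lin pi f = 0.
Proof.
have [TS _ Trad] := Tflat.
have [b] := ubnP (msize f); elim: b f => // b ih f; rewrite ltnS => fb locf.
have dsub i : mderiv i (sub_lin pi f) = 0.
  have -> : mderiv i (sub_lin pi f) = dd (delta_mx i 0) (sub_lin pi f).
    rewrite /dd (bigD1 i) //= mxE !eqxx scale1r big1 ?addr0 // => j ji.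
    by rewrite mxE (negPf ji) scale0r.
  rewrite dd_sub_lin.
  case: b ih fb => [|b] ih fb.
    have -> : f = 0 by apply/eqP; rewrite -msize_poly_eq0 -leqn0.
    by rewrite -mpolyC0 ddC -mpolyC0 sub_linC.
  apply: ih; first by rewrite ltnS msize_dd.
  apply: annx_loc_dd => //; first exact: subsetDl.
  move=> s; rewrite !inE negb_and negbK => /andP[/orP[sT|/negP//] _].
  by rewrite mulmxA root_proj // mul0mx.
have iR := radical_ideal (annx_loc_ideal M (S :\: T)).
have [R0 RD RM] := iR.
have : radical loc (f - sub_lin pi f).
  have := sub_lin_congr R0 RD RM (X := 1%:M) (Y := pi) _ f.
  rewrite sub_lin1; apply => i; rewrite opprB addrC subrK row_mul.
  exact: ideal_lin_root_mx.
rewrite (mderiv_eq0_const dsub); set k := (_)@__.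
move=> /(idealB iR (sub_radical locf)); rewrite opprB addrC subrK => -[j].
rewrite -rmorphXn => /annx_loc_cst /eqP; rewrite expf_eq0 => /andP[_ /eqP ->].
by rewrite mpolyC0.
Qed.

(** J is stable under W, so vanishing on the flat extends to its translates. *)
Lemma annx_vanish f w (y : 'cV_n) : annx f -> root_mx T *m y = 0 ->
  f.@[fun i => (rhoC w *m y) i 0] = 0.
Proof.
move=> fM yT; have /annx_loc_vanish h : loc (wx w^-1 f).
  by exists 0%N; rewrite expr0 mul1r; apply: annx_wx.
have := congr1 (meval (fun i => y i 0)) h; rewrite meval0 meval_sub_lin.
by rewrite flat_proj_id // meval_sub_lin invgK.
Qed.

Hypothesis Msimple : simple_module M.

(** The vectors killed by a power of f form a submodule: f commutes with [h^*] and W, and y f^(k+1)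
    = f^(k+1) y + (k+1) f^k D_y f, so that applying y costs at most one more power. This submodule
    is nonzero, hence equal to M. *)
Lemma locally_nilpotent f : (forall s, wx s f = f) ->
  (exists2 m : M, m <> 0 & px f *: m = 0) ->
  forall m : M, exists k, px (f ^+ k) *: m = 0.
Proof.
move=> fW [m0 m00 fm0].
pose N := [set m : M | exists k, px (f ^+ k) *: m = 0]%classic.
have fkW k s : wx s (f ^+ k) = f ^+ k.
  elim: k => [|k ih]; first by rewrite expr0 -mpolyC1 /wx sub_linC.
  by rewrite exprS {1}/wx sub_linM -/(wx s _) -/(wx s _) ih fW.
have NS k l (m : M) : px (f ^+ k) *: m = 0 -> px (f ^+ (k + l)) *: m = 0.
  by move=> h; rewrite addnC exprD pxM -scalerA h scaler0.
have subN : submodule N.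
  apply: stable_set_submodule => /=.
  - by exists 0%N; rewrite scaler0.
  - move=> u v [k hk] [l hl]; exists (k + l)%N.
    by rewrite scalerDr NS // addnC NS // addr0.
  - by move=> a u [k hk]; exists k; rewrite scalerA -cstC -scalerA hk scaler0.
  - move=> x u [k hk]; exists k.
    by rewrite scalerA -px_lin px_commC -scalerA hk scaler0.
  - move=> y u [k hk]; exists k.+1.
    have := invariant_comm c gramB reflS rootS y (fun s _ => fkW k.+1 s).
    move=> /(congr1 (fun a : H => a *: u)); rewrite scalerDl -!scalerA.
    rewrite ddXn; have -> : px (f ^+ k.+1) *: u = 0 by rewrite -addn1 NS.
    rewrite scaler0.
    suff -> : px (f ^+ k * dd y f *+ k.+1) *: u = 0 by rewrite addr0.
    by rewrite -mulr_natl mulrA mulrAC pxM -scalerA hk scaler0.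
  - move=> w u [k hk]; exists k.
    by rewrite scalerA -[f ^+ k](fkW k w) -hw_px -scalerA hk scaler0.
have [_ /(_ N subN) [N0|NT]] := Msimple; last first.
  by move=> m; have : N m by rewrite NT.
have : N m0 by exists 1%N; rewrite expr1.
by rewrite N0.
Qed.

(** The product f is W-invariant and has among its factors a combination of roots in [T], so d^j f^k
    is in J for some j and k. If f were injective on M, then d^j would be in J, against the choice
    of [T]; so f kills a nonzero vector. *)
Lemma orbit_product_nilpotent x (f := \prod_w wx w (lin (x *m root_mx T))) :
  forall m : M, exists k, px (f ^+ k) *: m = 0.
Proof.
have [TS hT Trad] := Tflat; apply: locally_nilpotent => [s|].
  rewrite /f [LHS]rmorph_prod /= -/(wx _).
  rewrite [RHS](reindex_inj (mulgI s)); apply: eq_bigr => w _.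
  exact: wxM.
have : radical loc f.
  have [_ _ RM] := radical_ideal (annx_loc_ideal M (S :\: T)).
  rewrite /f (bigD1 1%g) //= wx1 mulrC; apply: (RM).
  exact: (ideal_lin_root_mx (radical_ideal (annx_loc_ideal _ _)) Trad).
case=> k [j hkj]; apply: contrapT => /forall2NP h.
have inj (m : M) : px f *: m = 0 -> m = 0.
  by move=> fm; case: (h m) => // /contrapT.
have injk l (m : M) : px (f ^+ l) *: m = 0 -> m = 0.
  elim: l m => [|l ih] m; first by rewrite expr0 px1 scale1r.
  by rewrite exprS pxM -scalerA => /inj /ih.
apply: (hT j) => m; apply: (injk k); have := hkj m.
by rewrite mulrC pxM -scalerA.
Qed.

End Flat.

(** * Generic points, and parabolic subgroups attached to flats *)

Lemma poly_nat_roots (K : numFieldType) (p : {poly K}) :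
  (forall k : nat, p.[k%:R] = 0) -> p = 0.
Proof.
move=> allroot; apply: contrapT => /eqP p0.
pose rs := [seq k%:R : K | k <- iota 0 (size p)].
have ar : all (root p) rs by apply/allP => _ /mapP[k _ ->]; apply/eqP/allroot.
have ur : uniq rs.
  by rewrite map_inj_uniq ?iota_uniq // => j k /eqP; rewrite eqr_nat => /eqP.
by have := max_poly_roots p0 ar ur; rewrite size_map size_iota ltnn.
Qed.

(** The vector is found on the moment curve (1, k, k^2, ...): each form restricts to a nonzero
    polynomial in k, and the product of these polynomials is nonzero at some natural number. *)
Lemma generic_vector (K : numFieldType) (I : finType) m (L : I -> 'rV[K]_m) :
  (forall i, L i != 0) -> exists t : 'cV_m, forall i, (L i *m t) 0 0 != 0.
Proof.
move=> L0; pose Q i : {poly K} := \sum_(j < m) L i 0 j *: 'X^j.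
have Q0 i : Q i != 0.
  apply: contra (L0 i) => /eqP Q0; apply/eqP/rowP => j; rewrite mxE.
  have := congr1 (fun p : {poly K} => p`_j) Q0; rewrite coef0 coef_sum => <-.
  rewrite (bigD1 j) //= coefZ coefXn eqxx mulr1 big1 ?addr0 // => k kj.
  by rewrite coefZ coefXn eq_sym [_ == _](negPf kj) mulr0.
pose P := \prod_i Q i; have P0 : P != 0 by apply/prodf_neq0.
have [k Pk] : exists k : nat, P.[k%:R] != 0.
  apply: contrapT => /forallNP h; case/eqP: P0; apply: poly_nat_roots => k.
  by apply/eqP/negPn/negP/h.
exists (\col_(j < m) k%:R ^+ j) => i.
have -> : (L i *m \col_(j < m) k%:R ^+ j) 0 0 = (Q i).[k%:R].
  rewrite mxE horner_sum; apply: eq_bigr => j _.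
  by rewrite mxE hornerZ hornerXn.
move: Pk; rewrite horner_prod => /prodf_neq0; exact.
Qed.

Section GenericPoints.
Variables (R : realType) (n : nat) (W : finGroupType).
Variables (rho : mx_representation R [set: W]%G n) (B : 'M[R]_n).
Variables (S : {set W}) (alpha : W -> 'rV[R[i]]_n).
Hypothesis gramB : is_gram B.
Hypothesis reflS : forall s, s \in S -> is_reflection B (rho s).
Hypothesis rootS : forall s, s \in S -> is_root rho s (alpha s).
Local Notation rhoC := (rhoC rho).
Local Notation root_mx := (root_mx alpha).
Local Notation flat_proj := (flat_proj alpha).

(** If the orbit of [a] avoids the flat, a single combination of the roots in [T] is nonzero on the
    whole orbit; its orbit product then separates [a] from the translates of the flat. *)
Lemma generic_root (T : {set W}) (a : 'cV_n) :
  (forall w, root_mx T *m (rhoC w *m a) != 0) ->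
  exists x : 'rV_#|W|, forall w, (x *m root_mx T *m (rhoC w *m a)) 0 0 != 0.
Proof.
move=> h; have [w|t tE] := @generic_vector _ W _ (fun w => (root_mx T *m (rhoC w *m a))^T).
  by rewrite trmx_eq0.
exists t^T => w; have := tE w.
rewrite -mulmxA; set X := root_mx T *m _.
by have -> : t^T *m X = (X^T *m t)^T; [rewrite trmx_mul trmxK|rewrite [in X in _ -> X]mxE].
Qed.

(** [P] is the isotropy group of a generic point [v] of the flat: an element fixing [v] fixes the
    flat pointwise. Conversely the reflections in [T] belong to [P], so the fixed vectors of [P] lie
    in the flat. *)
Lemma flat_parabolic (T : {set W}) : T \subset S ->
  exists2 P : {set W}, parabolic rho P &
    forall y, (forall w, w \in P -> act_h rho w y = y) <-> root_mx T *m y = 0.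
Proof.
move=> TS; pose X w := (rhoC w - 1%:M) *m flat_proj T.
(* [X w] is zero exactly when w fixes the flat pointwise; otherwise a nonzero row of it is a linear
   form that [t] must avoid. *)
have /choice[i iE] : forall w, exists i : option 'I_n,
    if i is Some i then row i (X w) != 0 else X w = 0.
  move=> w; have [->|X0] := eqVneq (X w) 0; first by exists None.
  have [i Xi] : exists i, row i (X w) != 0.
    apply: contrapT => /forallNP h; case/eqP: X0; apply/row_matrixP => i.
    by rewrite row0; apply/eqP/negPn/negP/h.
  by exists (Some i).
have [w|t tE] := @generic_vector R[i] {w : W | i w != None} n
    (fun w => if i (val w) is Some k then row k (X (val w)) else 0).
  by have := iE (val w); have := valP w; case: (i _).
pose v := flat_proj T *m t.
have rv : root_mx T *m v = 0 by rewrite mulmxA root_mx_proj mul0mx.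
have stab w : act_h rho w v = v -> X w = 0.
  move=> wv; have Xt : X w *m t = 0.
    by rewrite -mulmxA -/v mulmxBl mul1mx; apply/eqP; rewrite subr_eq0; apply/eqP.
  case iw : (i w) => [k|]; last by have := iE w; rewrite iw.
  have iw' : i w != None by rewrite iw.
  have := tE (exist _ w iw'); rewrite /= iw -row_mul Xt row0 mxE eqxx.
  by [].
exists [set w | act_h rho w v == v]%SET; first by exists v.
move=> y; split=> [yP|yT w].
  apply/root_mx_eq0 => s sT; have sS := fintype.subsetP TS _ sT.
  have [_ rS] := rootS sS.
  have sv : act_h rho s v = v.
    rewrite /act_h -/(rhoC s) (rhoC_refl gramB reflS rootS sS) mulmxBl mul1mx.
    by have /root_mx_eq0 /(_ s sT) av := rv; rewrite -mulmxA av mulmx0 subr0.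
  have /rS : act_h rho s y = y by apply: yP; rewrite inE sv.
  rewrite /pairing => h; apply/matrixP => j k.
  by rewrite !ord1 h mxE.
rewrite inE => /eqP /stab Xw; apply/eqP; rewrite -subr_eq0.
rewrite /act_h -/(rhoC w) -{2}[y]mul1mx -mulmxBl -(flat_proj_id yT) mulmxA.
by rewrite -/(X w) Xw mul0mx.
Qed.

End GenericPoints.

(** * A finite-dimensional generating subspace stable under h and W *)

Section FiniteDimensional.
Variables (R : realType) (n : nat) (W : finGroupType).
Variables (rho : mx_representation R [set: W]%G n) (B : 'M[R]_n).
Variables (S : {set W}) (alpha : W -> 'rV[R[i]]_n) (c : W -> R[i]).
Local Notation H := (cherednik rho B S alpha c).
Local Notation hy := (@hy R n W rho B S alpha c).
Local Notation hw := (@hw R n W rho B S alpha c).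
Local Notation hcst := (@hcst R n W rho B S alpha c).
Local Notation py := (@py R n W rho B S alpha c).
Local Notation rhoC := (rhoC rho).
Local Notation wy := (wy rho).
Local Notation poly := {mpoly R[i][n]}.

Definition wy_invariant (f : poly) : Prop := forall w, wy w f = f.

(** The product of the X - w ['X_j] over w in W witnesses that ['X_j] is integral over the
    invariants. *)
Lemma orbit_poly j : exists q : {poly poly},
  [/\ q \is monic, size q = #|W|.+1, q.['X_j] = 0 & forall i, wy_invariant q`_i].
Proof.
pose rs := [seq wy w 'X_j | w <- enum W].
exists (\prod_(a <- rs) ('X - a%:P)); split.
- exact: monic_prod_XsubC.
- by rewrite size_prod_XsubC size_map -cardE.
- apply/rootP; rewrite root_prod_XsubC; apply/mapP; exists 1%g; first by rewrite mem_enum.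
  by rewrite wy1.
move=> i u; set t := [tuple lin (row k (rhoC u)^T) | k < n]; set q := \prod_(_ <- _) _.
have -> : wy u q`_i = (map_poly (comp_mpoly t) q)`_i by rewrite coef_map.
congr ((polyseq _)`_i); rewrite /q big_map big_enum rmorph_prod /=.
rewrite [RHS](reindex_inj (mulgI u)) /=.
apply: eq_bigr => w _; rewrite rmorphB /= map_polyX map_polyC /=.
by rewrite -[comp_mpoly t _]/(wy u (wy w 'X_j)) wyM.
Qed.

Lemma invariant_reduction j k : exists d : nat -> poly,
  (forall i, wy_invariant (d i)) /\ 'X_j ^+ k = \sum_(i < #|W|) d i * 'X_j ^+ i.
Proof.
have [q [qm qs q0 qW]] := orbit_poly j.
suff [r [rs rW rE]] : exists r : {poly poly},
    [/\ (size r <= #|W|)%N, forall i, wy_invariant r`_i & r.['X_j] = 'X_j ^+ k].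
  by exists (fun i => r`_i); split => //; rewrite -rE (horner_coef_wide _ rs).
have W0 : (0 < #|W|)%N by apply/card_gt0P; exists 1%g.
elim: k => [|k [r [rs rW rE]]].
  exists 1; split; first by rewrite size_poly1.
    move=> i w; rewrite coef1; case: eqP => _ /=; first exact: sub_linC.
    exact: sub_linC.
  by rewrite hornerC.
(* One step of division by the monic [q]: the term of degree [#|W|] is cancelled, and the value at
   ['X_j] is unchanged because [q] vanishes there. *)
exists ('X * r - r`_(#|W|.-1) *: q); split.
- apply/leq_sizeP => i Wi; rewrite coefB coefXM coefZ.
  have -> : (i == 0)%N = false by rewrite gtn_eqF // (leq_trans W0).
  move: Wi; rewrite leq_eqVlt => /orP[/eqP <-|Wi].
    have /eqP : lead_coef q = 1 by apply/eqP.
    by rewrite /lead_coef qs /= => /eqP ->; rewrite mulr1 subrr.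
  rewrite [q`_i]nth_default ?qs // mulr0 subr0 nth_default //.
  by rewrite (leq_trans rs) // -ltnS prednK // (leq_trans W0) // ltnW.
- move=> i w; rewrite coefB coefXM coefZ /wy -[X in _ + X]scaleN1r sub_linD sub_linZ sub_linM.
  have rWw k' : sub_lin (rhoC w)^T r`_k' = r`_k' by apply: rW.
  have -> : sub_lin (rhoC w)^T q`_i = q`_i by apply: qW.
  rewrite rWw scaleN1r; congr (_ - _).
  by case: eqP => _; [exact: sub_linC|exact: rW].
- by rewrite hornerD hornerN hornerZ q0 mulr0 subr0 hornerM hornerX rE exprS.
Qed.

Lemma invariant_py f : wy_invariant f -> @invariant_poly_y R n W rho B S alpha c (py f).
Proof.
move=> fW; split=> [|w]; last first.
  by rewrite hw_py fW -mulrA -hwM mulgV hw1 mulr1.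
elim/mpoly_ring_ind: {fW} f => [k|i|f g|f g].
- by rewrite pyC; apply: poly_y_cst.
- by rewrite pyX; apply: poly_y_gen.
- by rewrite pyD; apply: poly_y_add.
- by rewrite pyM; apply: poly_y_mul.
Qed.

Variable M : lmodType H.

Section Span.
Variables (I : finType) (v : I -> M).

Definition spanned (u : M) : Prop := exists k : I -> R[i], u = \sum_i hcst (k i) *: v i.

Lemma spanned0 : spanned 0.
Proof. by exists (fun=> 0); rewrite big1 // => i _; rewrite cst0 scale0r. Qed.

Lemma spannedD a b : spanned a -> spanned b -> spanned (a + b).
Proof.
move=> [k ->] [l ->]; exists (fun i => k i + l i); rewrite -big_split.
by apply: eq_bigr => i _; rewrite cstD scalerDl.
Qed.

Lemma spannedZ k a : spanned a -> spanned (hcst k *: a).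
Proof.
move=> [l ->]; exists (fun i => k * l i); rewrite scaler_sumr.
by apply: eq_bigr => i _; rewrite cstM scalerA.
Qed.

Lemma spanned_sum (J : Type) (r : seq J) (P : pred J) (F : J -> M) :
  (forall j, P j -> spanned (F j)) -> spanned (\sum_(j <- r | P j) F j).
Proof. by move=> h; elim/big_ind: _ => //; [apply: spanned0|apply: spannedD]. Qed.

Lemma spanned_mem i : spanned (v i).
Proof.
exists (fun j => (j == i)%:R); rewrite (bigD1 i) //= eqxx cst1 scale1r.
by rewrite big1 ?addr0 // => j /negPf ->; rewrite cst0 scale0r.
Qed.

(** A dependence among the first [#|I|.+1] vectors z^k m is divided by its last nonzero coefficient
    and multiplied by a power of z. The relation becomes monic of degree exactly [#|I|.+1], a degree
    that depends neither on z nor on m. *)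
Lemma linear_relation (z : H) (m : M) :
  (forall k, spanned (z ^+ k *: m)) ->
  exists a : nat -> R[i],
    z ^+ #|I|.+1 *: m = \sum_(k < #|I|.+1) hcst (a k) *: (z ^+ k *: m).
Proof.
move=> /choice[K KE]; pose X := \matrix_(k < #|I|.+1, i < #|I|) K k (enum_val i).
have [u u0 uX] : exists2 u : 'rV_(#|I|.+1), u != 0 & u *m X = 0.
  have : kermx X != 0.
    by rewrite kermx_eq0 /row_free ltn_eqF // ltnS rank_leq_col.
  move=> /eqP k0; have [i ri] : exists i, row i (kermx X) != 0.
    apply: contrapT => /forallNP h; apply: k0; apply/row_matrixP => i.
    by rewrite row0; apply/eqP/negPn/negP/h.
  by exists (row i (kermx X)) => //; rewrite -row_mul mulmx_ker row0.
have rel : \sum_(k < #|I|.+1) hcst (u 0 k) *: (z ^+ k *: m) = 0.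
  under eq_bigr do rewrite KE scaler_sumr.
  rewrite exchange_big big1 // => i _ /=.
  under eq_bigr do rewrite scalerA -cstM.
  rewrite -scaler_suml -(big_morph hcst (@cstD _ _ _ rho B S alpha c) (erefl 0)).
  have := congr1 (fun Y : 'rV_#|I| => Y 0 (enum_rank i)) uX.
  rewrite !mxE => uE; rewrite [X in hcst X](_ : _ = 0) ?cst0 ?scale0r // -[RHS]uE.
  by apply: eq_bigr => k _; rewrite mxE enum_rankK.
pose D := #|I|.+1; pose Q := \poly_(k < D) u 0 (inord k).
have Q0 : Q != 0.
  have /rV0Pn[k uk] := u0; apply: contraNneq uk => Q0.
  have := congr1 (fun p : {poly R[i]} => p`_k) Q0.
  by rewrite coef_poly coef0 ltn_ord inord_val => ->.
(* [ev b p] is p(z) m, with the coefficients of p of index at least b left out. *)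
pose ev b (p : {poly R[i]}) := \sum_(0 <= k < b) hcst p`_k *: (z ^+ k *: m).
have evX b p : ev b.+1 ('X * p) = z *: ev b p.
  rewrite /ev !big_mkord big_ord_recl coefXM /= cst0 scale0r add0r scaler_sumr.
  apply: eq_bigr => k _; rewrite coefXM /= !scalerA; congr (_ *: _).
  by rewrite exprS mulrA cstC.
have evQ j : ev (j + D)%N ('X^j * Q) = 0.
  elim: j => [|j ih]; last by rewrite addSn exprS -mulrA evX ih scaler0.
  rewrite expr0 mul1r /ev big_mkord -[RHS]rel; apply: eq_bigr => k _.
  by rewrite coef_poly ltn_ord inord_val.
have sQ : (0 < size Q <= D)%N by rewrite size_poly_gt0 Q0 size_poly.
(* The shift by [j] brings the leading coefficient of [Q] to degree [D]. *)
pose j := (D - (size Q).-1)%N; pose P := (lead_coef Q)^-1 *: ('X^j * Q).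
have Pc k : P`_k = (lead_coef Q)^-1 * (if (k < j)%N then 0 else Q`_(k - j)).
  by rewrite coefZ coefXnM.
have jQ : (j + (size Q).-1)%N = D.
  by rewrite subnK //; case/andP: sQ => _; apply: leq_trans (leq_pred _).
have PD : P`_D = 1.
  by rewrite Pc -{1 2}jQ ltnNge leq_addr /= addKn -/(lead_coef Q) mulVf ?lead_coef_eq0.
have j0 : (0 < j)%N by rewrite subn_gt0; case/andP: sQ => /prednK {1}<-.
have : ev D.+1 P = 0.
  transitivity (ev (j + D)%N P).
    rewrite [RHS](@big_cat_nat _ _ _ D.+1) //=; last first.
      by rewrite -add1n leq_add2r.
    rewrite [X in _ = _ + X]big_nat_cond
      [X in _ = _ + X]big1 ?addr0 // => k /andP[/andP[Dk _] _].
    rewrite Pc ifN; last by rewrite -leqNgt (leq_trans _ Dk) // -jQ leqW ?leq_addr.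
    rewrite [Q`_ _]nth_default ?mulr0 ?cst0 ?scale0r //.
    rewrite leq_subRL; last by rewrite (leq_trans _ Dk) // -jQ leqW ?leq_addr.
    by rewrite (leq_trans _ Dk) // -jQ -addnS leq_add2l leqSpred.
  rewrite /ev /P; under eq_bigr do rewrite coefZ cstM -scalerA.
  by rewrite -scaler_sumr -/(ev _ _) evQ scaler0.
rewrite /ev big_nat_recr //= PD cst1 scale1r big_mkord => /eqP.
rewrite addrC addr_eq0 => /eqP ->; exists (fun k => - P`_k).
rewrite -sumrN; apply: eq_bigr => k _; rewrite -scaleNr; congr (_ *: _).
by rewrite cstN.
Qed.

End Span.

Lemma spanned_image (I J : finType) (v : I -> M) (v' : J -> M) (z : H) u :
  (forall k, z * hcst k = hcst k * z) ->
  (forall i, spanned v' (z *: v i)) -> spanned v u -> spanned v' (z *: u).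
Proof.
move=> zC h [k ->]; rewrite scaler_sumr; apply: spanned_sum => i _.
by rewrite scalerA zC -scalerA; apply: spannedZ.
Qed.

Lemma hcst_comm (a : H) k : a * hcst k = hcst k * a.
Proof. by rewrite cstC. Qed.

(** Powers of a variable are combinations of its powers below [#|W|] with invariant coefficients,
    and invariants send m into the finite span given by local finiteness. The size of the resulting
    spanning family, hence [K], is the same for all variables. *)
Lemma py_linear_relation (m : M) :
  locally_finite M (@invariant_poly_y R n W rho B S alpha c) ->
  exists K, forall j, exists a : nat -> R[i],
    py ('X_j ^+ K.+1) *: m = \sum_(k < K.+1) hcst (a k) *: (py ('X_j ^+ k) *: m).
Proof.
move=> /(_ m)[e he]; exists #|{: 'I_#|W| * 'I_(size e)}| => j.
pose v (p : 'I_#|W| * 'I_(size e)) := py ('X_j ^+ p.1) *: e`_p.2.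
have pyXn k : py ('X_j ^+ k) = py 'X_j ^+ k.
  by elim: k => [|k ih]; rewrite ?expr0 ?py1 // !exprS pyM ih.
have [k|a aE] := @linear_relation _ v (py 'X_j) m.
  rewrite -pyXn; have [d [dW ->]] := invariant_reduction j k.
  rewrite py_sum scaler_suml; apply: spanned_sum => i _.
  have [b bE] := he _ (invariant_py (dW i)).
  rewrite mulrC pyM -scalerA bE scaler_sumr; apply: spanned_sum => l _.
  rewrite scalerA hcst_comm -scalerA; apply: spannedZ.
  exact: (spanned_mem v (i, l)).
by exists a; rewrite pyXn aE; apply: eq_bigr => k _; rewrite pyXn.
Qed.

(** The family consists of the w y^b m with all exponents of b at most [K]. W permutes it. As y w =
    w (w^-1 y), it suffices to multiply y^b m by a coordinate, which raises one exponent; the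
    exponent [K.+1] is reduced by the linear relation. *)
Lemma exists_finite_module (m : M) :
  locally_finite M (@invariant_poly_y R n W rho B S alpha c) ->
  exists (I : finType) (v : I -> M), [/\ exists i, v i = m,
    forall w i, spanned v (hw w *: v i) & forall y i, spanned v (hy y *: v i)].
Proof.
move=> /(py_linear_relation m)[K KE].
pose mon (b : {ffun 'I_n -> 'I_K.+1}) : poly := \prod_j 'X_j ^+ b j.
pose v (p : W * {ffun 'I_n -> 'I_K.+1}) := hw p.1 *: (py (mon p.2) *: m).
exists _, v; split.
- exists (1%g, [ffun=> ord0]); rewrite /v /mon big1 => [|j _].
    by rewrite hw1 py1 !scale1r.
  by rewrite ffunE expr0.
- move=> u [w b]; rewrite /v scalerA -hwM; exact: (spanned_mem v (u * w, b)%g).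
move=> y [w b]; rewrite /v scalerA /=.
have -> : hy y * hw w = hw w * hy (rhoC w^-1 *m y).
  by rewrite hwy mulmxA rhoCV mul1mx.
move: (rhoC _ *m y) => {}y; rewrite -scalerA.
apply: (@spanned_image _ _ (fun b => py (mon b) *: m)) => [k|{}b|].
- exact: hcst_comm.
- exact: (spanned_mem v (w, b)).
have -> : hy y = \sum_j hcst (y j 0) * hy (delta_mx j 0).
  rewrite {1}[y]matrix_sum_delta (big_morph hy (@hyD _ _ _ _ _ _ _ _) (hy0 _ _ _ _ _)).
  by apply: eq_bigr => j _; rewrite big_ord1 hyZ.
rewrite scaler_suml; apply: spanned_sum => j _; rewrite -scalerA; apply: spannedZ.
pose rest := \prod_(k | k != j) 'X_k ^+ b k : poly.
have monE l : mon [ffun k => if k == j then l else b k] = rest * 'X_j ^+ l.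
  rewrite /mon (bigD1 j) //= ffunE eqxx mulrC; congr (_ * _).
  by apply: eq_bigr => k /negPf kj; rewrite ffunE kj.
have -> : mon b = rest * 'X_j ^+ b j by rewrite /mon (bigD1 j) //= mulrC.
rewrite scalerA -pyX -pyM mulrCA -exprS pyM -scalerA.
have [a aE] : exists a : nat -> R[i],
  py ('X_j ^+ (b j).+1) *: m = \sum_(k < K.+1) hcst (a k) *: (py ('X_j ^+ k) *: m).
  have := ltn_ord (b j); rewrite leq_eqVlt => /orP[/eqP ->|bK]; first exact: KE.
  exists (fun k => (k == (b j).+1)%:R).
  rewrite (bigD1 (Ordinal bK)) //= eqxx cst1 scale1r big1 ?addr0 // => k.
  by rewrite -val_eqE /= => /negPf ->; rewrite cst0 scale0r.
rewrite aE scaler_sumr; apply: spanned_sum => k _.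
rewrite scalerA hcst_comm -scalerA; apply: spannedZ.
rewrite scalerA -pyM -monE.
exact: (spanned_mem (fun b => py (mon b) *: m)).
Qed.

End FiniteDimensional.

(** * Filtration of M by degree in C[h] *)

Lemma meval_scale_monomial (K : comNzRingType) n (m : 'X_{1..n}) (s : K) (y : 'I_n -> K) :
  \prod_i (s * y i) ^+ m i = s ^+ mdeg m * \prod_i y i ^+ m i.
Proof.
under eq_bigr do rewrite exprMn.
by rewrite big_split /= prodrXr mdegE.
Qed.

Lemma meval_scale_homog (K : comNzRingType) n d (f : {mpoly K[n]}) (s : K) y :
  f \is d.-homog -> f.@[fun i => s * y i] = s ^+ d * f.@[y].
Proof.
move=> /dhomogP fd; rewrite !mevalE mulr_sumr !big_seq; apply: eq_bigr => m mf.
by rewrite meval_scale_monomial [mdeg m](fd m mf) mulrCA.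
Qed.

Section PolynomialFiltration.
Variables (R : realType) (n : nat) (W : finGroupType).
Variables (rho : mx_representation R [set: W]%G n) (B : 'M[R]_n).
Variables (S : {set W}) (alpha : W -> 'rV[R[i]]_n) (c : W -> R[i]).
Local Notation H := (cherednik rho B S alpha c).
Local Notation hx := (@hx R n W rho B S alpha c).
Local Notation hy := (@hy R n W rho B S alpha c).
Local Notation hw := (@hw R n W rho B S alpha c).
Local Notation hcst := (@hcst R n W rho B S alpha c).
Local Notation px := (@px R n W rho B S alpha c).
Local Notation poly := {mpoly R[i][n]}.
Variables (M : lmodType H) (I : finType) (v : I -> M).
Hypothesis Msimple : simple_module M.
Hypothesis v0 : exists i, v i <> 0.
Hypothesis vw : forall w i, spanned v (hw w *: v i).
Hypothesis vy : forall y i, spanned v (hy y *: v i).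
Local Notation annx := (@annx R n W rho B S alpha c M).

Inductive xfil : nat -> M -> Prop :=
  | xfil_gen i : xfil 0 (v i)
  | xfil_0 : xfil 0 0
  | xfil_add d u u' : xfil d u -> xfil d u' -> xfil d (u + u')
  | xfil_cst d k u : xfil d u -> xfil d (hcst k *: u)
  | xfil_S d u : xfil d u -> xfil d.+1 u
  | xfil_x d x u : xfil d u -> xfil d.+1 (hx x *: u).

Lemma xfil_leq d d' u : (d <= d')%N -> xfil d u -> xfil d' u.
Proof.
move=> /subnKC <-; elim: (d' - d)%N => [|k ih] h; first by rewrite addn0.
by rewrite addnS; apply/xfil_S/ih.
Qed.

Lemma spanned_xfil u : spanned v u -> xfil 0 u.
Proof.
move=> [k ->]; elim/big_ind: _ => [|a b|i _]; first exact: xfil_0.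
  exact: xfil_add.
exact/xfil_cst/xfil_gen.
Qed.

Lemma xfil_w w d u : xfil d u -> xfil d (hw w *: u).
Proof.
elim=> {d u} [i||d u u' _ h _ h'|d k u _ h|d u _ h|d x u _ h].
- exact/spanned_xfil.
- by rewrite scaler0; apply: xfil_0.
- by rewrite scalerDr; apply: xfil_add.
- by rewrite scalerA -cstC -scalerA; apply: xfil_cst.
- exact: xfil_S.
- by rewrite scalerA hwx -scalerA; apply: xfil_x.
Qed.

(** The y's do not raise the degree, since y x - x y is a combination of elements of W and these
    preserve each step. This makes the y's nilpotent on gr M. *)
Lemma xfil_y y d u : xfil d u -> xfil d (hy y *: u).
Proof.
elim=> {d u} [i||d u u' _ h _ h'|d k u _ h|d u _ h|d x u hu h].
- exact/spanned_xfil.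
- by rewrite scaler0; apply: xfil_0.
- by rewrite scalerDr; apply: xfil_add.
- by rewrite scalerA -cstC -scalerA; apply: xfil_cst.
- exact: xfil_S.
rewrite scalerA hyx_act !scalerDl scaler_suml -scalerA.
apply: xfil_add; first by apply: xfil_add; [exact: xfil_x|exact/xfil_S/xfil_cst].
elim/big_ind: _ => [|a b|s _]; [exact: xfil_leq xfil_0|exact: xfil_add|].
by rewrite -scalerA; apply/xfil_S/xfil_cst/xfil_w.
Qed.

Lemma xfil_alg d d' a u : cherednik_fil rho B S alpha c d a -> xfil d' u ->
  xfil (d + d') (a *: u).
Proof.
move=> ha; elim: ha d' u =>
  {d a} [k|w|x|y|d a b _ iha _ ihb|d e a b _ iha _ ihb|d a _ ih] d' u hu.
- exact: xfil_cst.
- exact: xfil_w.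
- exact: xfil_x.
- by apply/xfil_S/xfil_y.
- by rewrite scalerDl; apply: xfil_add; [apply: iha|apply: ihb].
- by rewrite -scalerA -addnA; apply/iha/ihb.
- exact/xfil_S/ih.
Qed.

(** The union of the steps is a nonzero submodule of the simple module M. *)
Lemma xfil_exhaustive u : exists d, xfil d u.
Proof.
have [_ /(_ [set u | exists d, xfil d u]%classic)] := Msimple.
case=> [|N0|NT].
- apply: stable_set_submodule => /=.
  + by exists 0%N; apply: xfil_0.
  + move=> a b [d hd] [e he]; exists (d + e)%N; apply: xfil_add.
      by apply: xfil_leq hd; apply: leq_addr.
    by apply: xfil_leq he; apply: leq_addl.
  + by move=> k a [d hd]; exists d; apply: xfil_cst.
  + by move=> x a [d hd]; exists d.+1; apply: xfil_x.
  + by move=> y a [d hd]; exists d; apply: xfil_y.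
  + by move=> w a [d hd]; exists d; apply: xfil_w.
- have [i vi0] := v0; case: vi0.
  have : [set u | exists d, xfil d u]%classic (v i) by exists 0%N; apply: xfil_gen.
  by rewrite N0.
- by have : [set u | exists d, xfil d u]%classic u by rewrite NT.
Qed.

Lemma xfil_poly d u : xfil d u -> exists g : I -> poly,
  (forall i, (msize (g i) <= d.+1)%N) /\ u = \sum_i px (g i) *: v i.
Proof.
elim=> {d u} [i||d u u' _ [g [sg ->]] _ [g' [sg' ->]]|d k u _ [g [sg ->]]
  |d u _ [g [sg ->]]|d x u _ [g [sg ->]]].
- exists (fun j => (j == i)%:R%:MP); split => [j|].
    by rewrite msizeC; case: (_ != 0).
  rewrite (bigD1 i) //= eqxx mpolyC1 px1 scale1r big1 ?addr0 // => j /negPf ->.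
  by rewrite mpolyC0 px0 scale0r.
- exists (fun=> 0); split => [i|]; first by rewrite msize0.
  by rewrite big1 // => i _; rewrite px0 scale0r.
- exists (fun i => g i + g' i); split => [i|].
    by apply: leq_trans (msizeD_le _ _) _; rewrite geq_max sg sg'.
  by rewrite -big_split; apply: eq_bigr => i _; rewrite pxD scalerDl.
- exists (fun i => k *: g i); split => [i|].
    exact: leq_trans (msizeZ_le _ _) (sg i).
  by rewrite scaler_sumr; apply: eq_bigr => i _; rewrite scalerA pxZ.
- by exists g; split => // i; apply/leqW/sg.
exists (fun i => lin x * g i); split => [i|]; last first.
  by rewrite scaler_sumr; apply: eq_bigr => i _; rewrite scalerA pxM px_lin.
have [->|x0] := eqVneq (lin x) 0; first by rewrite mul0r msize0.
have [->|g0] := eqVneq (g i) 0; first by rewrite mulr0 msize0.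
rewrite msizeM // -ltnS prednK ?addn_gt0 ?lt0n ?msize_poly_eq0 ?x0 //.
have : (msize (lin x) <= 2)%N.
  rewrite /lin; apply: leq_trans (msize_sum _ _ _) _; elim/big_ind: _ => // [a b ha hb|j _].
    by rewrite geq_max ha.
  by apply: leq_trans (msizeZ_le _ _) _; rewrite msizeX mdeg1.
by move=> h; apply: leq_trans (leq_add h (sg i)) _.
Qed.

(* Cayley-Hamilton: [f - G] has a determinant annihilating [M], whose part of
   highest degree is a power of [f]. *)
Lemma leading_term_vanish d e f y : f \is d.-homog -> (e < d)%N ->
  (forall i, xfil e (px f *: v i)) ->
  (forall h, annx h -> forall t, h.@[fun i => (t *: y : 'cV_n) i 0] = 0) ->
  f.@[fun i => y i 0] = 0.
Proof.
move=> fd ed fv hy'; set a := _.@[_].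
have /choice[G GE] := fun i => xfil_poly (fv i).
pose r := #|I|; pose A : 'M[poly]_r :=
  f%:M - \matrix_(i, j) G (enum_val i) (enum_val j).
have Av i : \sum_j px (A i j) *: v (enum_val j) = 0.
  under eq_bigr do rewrite mxE [X in px (X + _)]mxE [X in px (_ + X)]mxE pxB scalerBl.
  rewrite sumrB (bigD1 i) //= eqxx mulr1n big1 => [|j ji]; last first.
    by rewrite eq_sym (negPf ji) mulr0n px0 scale0r.
  have [_ ->] := GE (enum_val i).
  rewrite addr0 (reindex _ (onW_bij _ (@enum_val_bij I))) /= -sumrB big1 // => j _.
  by rewrite mxE subrr.
have detM : annx (\det A).
  have detv i : px (\det A) *: v i = 0.
    have := mul_adj_mx A => /matrixP adjA.
    pose k := enum_rank i.
    transitivity (\sum_j px ((\adj A *m A) k j) *: v (enum_val j)).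
      rewrite (bigD1 k) //= adjA mxE eqxx mulr1n enum_rankK big1 ?addr0 // => j jk.
      by rewrite adjA mxE eq_sym (negPf jk) mulr0n px0 scale0r.
    under eq_bigr do rewrite mxE px_sum scaler_suml.
    rewrite exchange_big big1 // => l _ /=.
    under eq_bigr do rewrite pxM -scalerA.
    by rewrite -scaler_sumr Av scaler0.
  move=> u; have [b /xfil_poly[g [_ ->]]] := xfil_exhaustive u.
  rewrite scaler_sumr big1 // => i _.
  by rewrite scalerA px_commC -scalerA detv scaler0.
(* [Rm g] is s^d g(s^-1 y) as a polynomial in s; it vanishes at s = 0 when g has degree below d.
   Thus [Q] is s^d A(s^-1 y) for s nonzero, and at s = 0 it is the scalar matrix f(y). *)
pose Rm (g : poly) : {poly R[i]} :=
  \sum_(m <- msupp g) (g@_m * \prod_i y i 0 ^+ m i) *: 'X^(d - mdeg m).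
pose Q : 'M[{poly R[i]}]_r :=
  a%:P%:M - \matrix_(i, j) Rm (G (enum_val i) (enum_val j)).
have RmE s i j : s != 0 ->
    (Rm (G i j)).[s] = s ^+ d * (G i j).@[fun k => s^-1 * y k 0].
  move=> s0; rewrite /Rm horner_sum mevalE mulr_sumr !big_seq; apply: eq_bigr => m mG.
  rewrite hornerZ hornerXn meval_scale_monomial mulrCA -!mulrA; congr (_ * _).
  rewrite mulrC mulrA; congr (_ * _).
  have md : (mdeg m <= d)%N.
    have [sG _] := GE i; have := leq_trans (msize_mdeg_lt mG) (sG j).
    by move: ed; rewrite -/(_ < _)%N; lia.
  by rewrite -{2}(subnK md) exprD exprVn mulfK // expf_neq0.
have detQ s : s != 0 -> (\det Q).[s] = 0.
  move=> s0; rewrite -[_.[s]]/(horner_eval s _) -det_map_mx.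
  have -> : map_mx (horner_eval s) Q =
      s ^+ d *: map_mx (meval (fun i => (s^-1 *: y : 'cV_n) i 0)) A.
    apply/matrixP => i j; rewrite !mxE /horner_eval hornerD hornerN.
    rewrite mevalB mulrBr; congr (_ - _); last first.
      by rewrite RmE //; congr (_ * _); apply: meval_eq => k; rewrite mxE.
    case: eqVneq => ij; last by rewrite !mulr0n horner0 meval0 mulr0.
    rewrite !mulr1n hornerC (meval_eq _ (v2 := fun k => s^-1 * y k 0)) => [|k].
      by rewrite (meval_scale_homog _ _ fd) exprVn mulVKf // expf_neq0.
    by rewrite mxE.
  by rewrite detZ det_map_mx /= hy' // mulr0.
(* The determinant of [A] is in J, which vanishes on the line through y, so [\det Q] vanishes at all
   nonzero s. Hence it is zero, and its value at s = 0 is a power of f(y). *)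
have Q0 : \det Q = 0.
  have /eqP : \det Q * 'X = 0.
    apply: poly_nat_roots => k; rewrite hornerM hornerX.
    have [->|k0] := eqVneq (k%:R : R[i]) 0; first by rewrite mulr0.
    by rewrite detQ ?mul0r.
  by rewrite mulf_eq0 polyX_eq0 orbF => /eqP.
have := congr1 (horner_eval 0) Q0; rewrite -det_map_mx.
have -> : map_mx (horner_eval 0) Q = a%:M.
  apply/matrixP => i j; rewrite !mxE /horner_eval hornerD hornerN.
  have -> : (Rm (G (enum_val i) (enum_val j))).[0] = 0.
    rewrite /Rm horner_sum big_seq big1 // => m mG.
    have [sG _] := GE (enum_val i).
    have md : (0 < d - mdeg m)%N.
      rewrite subn_gt0; apply: leq_trans ed.
      exact: leq_trans (msize_mdeg_lt mG) (sG _).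
    by rewrite hornerZ hornerXn expr0n gtn_eqF // mulr0.
  by rewrite subr0; case: eqVneq => _; rewrite ?mulr1n ?mulr0n ?hornerC ?horner0.
rewrite det_scalar /horner_eval horner0 => /eqP.
by rewrite expf_eq0 => /andP[_ /eqP].
Qed.

End PolynomialFiltration.

(** * Symbols in the associated graded module *)

Section GradedSymbols.
Local Open Scope quotient_scope.
Variables (A : pzRingType) (F : ring_filtration A) (M : lmodType A).
Variable G : mod_filtration F M.

(* The symbol, extended by 0, so that equations need no membership proofs. *)
Definition gsym (d : nat) (u : M) : graded G :=
  if pselect (G d u) is left h then symb h else 0.

Lemma symbE d u (h : G d u) : symb h = gsym d u.
Proof.
rewrite /gsym; case: pselect => [h'|//].
by congr symb; apply: Prop_irrelevance.
Qed.

Lemma gsym_eq d u u' : G d u -> G d u' -> mfil_pred G d (u - u') ->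
  gsym d u = gsym d u'.
Proof.
move=> h h' uu; rewrite -(symbE h) -(symbE h'); apply/graded_eqP => i /=.
by case: eqP => [->//|_]; rewrite subrr; apply: mfil_pred0.
Qed.

Lemma gsym0 d : gsym d 0 = 0.
Proof.
rewrite -(symbE (mfil0 G d)); apply/graded_eqP => i /=.
by case: eqP => _; rewrite subrr; apply: mfil_pred0.
Qed.

Lemma gsym_eq0 d u : mfil_pred G d u -> gsym d u = 0.
Proof.
move=> hu; rewrite -(gsym0 d); apply: gsym_eq; last by rewrite subr0.
  by case: d hu => [->|d /mfilS//]; apply: mfil0.
exact: mfil0.
Qed.

Lemma gsymD d u u' : G d u -> G d u' -> gsym d (u + u') = gsym d u + gsym d u'.
Proof.
move=> h h'; rewrite -(symbE h) -(symbE h') -(symbE (mfilD h h')) -pi_reesD.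
apply/graded_eqP => i /=; rewrite sub0r opprK.
by case: eqP => _; rewrite ?addr0 subrr; apply: mfil_pred0.
Qed.

Lemma pi_rees_sum (I : Type) (r : seq I) (f : I -> rees G) :
  exists2 u : rees G, \pi_(graded G) u = \sum_(i <- r) \pi_(graded G) (f i)
    & forall k, u k = \sum_(i <- r) f i k.
Proof.
elim: r => [|i r [u uE uk]]; first by exists (rees0 G) => [|k]; rewrite big_nil.
exists (rees_add (f i) u) => [|k]; first by rewrite big_cons -uE pi_reesD.
by rewrite big_cons -uk /= sub0r opprK.
Qed.

Lemma rees_sum_gsym (u : rees G) N : (forall i, (N <= i)%N -> u i = 0) ->
  \pi_(graded G) u = \sum_(d < N) gsym d (u d).
Proof.
move=> hN; under eq_bigr => d _ do rewrite -(symbE (reesP u d)).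
pose f (d : 'I_N) := Rees (symbP (reesP u d)) (symb_fin d (u d)).
have [r rE rk] := pi_rees_sum (index_enum 'I_N) f.
transitivity (\pi_(graded G) r); last exact: rE.
congr \pi; apply: rees_ext => i; rewrite rk.
have [iN|Ni] := ltnP i N.
  rewrite (bigD1 (Ordinal iN)) //= eqxx big1 ?addr0 // => k.
  by rewrite -val_eqE /= eq_sym => /negPf ->.
rewrite hN // big1 // => k _ /=.
by rewrite gtn_eqF // (leq_trans (ltn_ord k)).
Qed.

Lemma graded_decomposition (x : graded G) : exists N (u : nat -> M),
  (forall d, G d (u d)) /\ x = \sum_(d < N) gsym d (u d).
Proof.
elim/quotW: x => u; have [N hN] := rees_fin u; exists N, u; split; first exact: reesP.
exact: rees_sum_gsym.
Qed.

(** The sum of the homogeneous pieces of the graded module is direct. *)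
Lemma gsym_direct N (u : nat -> M) : (forall d, G d (u d)) ->
  \sum_(d < N) gsym d (u d) = 0 -> forall d, (d < N)%N -> mfil_pred G d (u d).
Proof.
move=> hu; pose s i := if (i < N)%N then u i else 0.
have sG i : G i (s i) by rewrite /s; case: ifP => _; [apply: hu|apply: mfil0].
have sN : exists K, forall i, (K <= i)%N -> s i = 0.
  by exists N => i; rewrite /s ltnNge => ->.
have -> : \sum_(d < N) gsym d (u d) = \pi_(graded G) (Rees sG sN).
  rewrite (@rees_sum_gsym _ N) /= => [|i]; last by rewrite /s ltnNge => ->.
  by apply: eq_bigr => d _; rewrite /s ltn_ord.
move=> /(graded_eqP (Rees sG sN) (rees0 G)) h d dN.
by have := h d; rewrite /= /s dN subr0.
Qed.

Lemma gsym_shift_direct j N (u : nat -> M) : (forall d, G (d + j)%N (u d)) ->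
  \sum_(d < N) gsym (d + j) (u d) = 0 ->
  forall d, (d < N)%N -> mfil_pred G (d + j)%N (u d).
Proof.
move=> hu u0 d dN; pose u' k := if (j <= k)%N then u (k - j)%N else 0.
have hu' k : G k (u' k).
  rewrite /u'; case: ifP => jk; last exact: mfil0.
  by rewrite -{1}(subnK jk); apply: hu.
have -> : u d = u' (d + j)%N by rewrite /u' leq_addl addnK.
apply: (gsym_direct hu' (N := (N + j)%N)); last by rewrite ltn_add2r.
rewrite -[RHS]u0 -[LHS](big_mkord xpredT (fun k => gsym k (u' k))).
rewrite (@big_cat_nat _ _ _ j) //= ?leq_addl //.
rewrite big_nat big1 ?add0r => [|k /andP[_ kj]]; last first.
  by rewrite /u' leqNgt kj gsym0.
rewrite -{1}[j]add0n big_addn addnK big_mkord; apply: eq_bigr => k _.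
by rewrite /u' leq_addl addnK.
Qed.

End GradedSymbols.

Section GradedAction.
Local Open Scope quotient_scope.
Variables (A : pzRingType) (F : ring_filtration A) (M : lmodType A).
Variable G : mod_filtration F M.
Local Notation gF := (reg_filtration F).

Lemma gsymZ i j (a : A) (u : M) : F i a -> G j u ->
  (gsym gF i (a : A^o) : gr_ring F) *: gsym G j u = gsym G (i + j) (a *: u).
Proof.
move=> ha hu; have hau : G (i + j)%N (a *: u) by apply: mfilZ.
have ha' : gF i a by [].
rewrite -(symbE ha') -(symbE hu) -(symbE hau).
rewrite -[LHS]/(graded_act _ _) -pi_rees_act; congr \pi; apply: rees_ext => k /=.
rewrite /conv; have [ik|ki] := leqP i k.
  have ik' : (i < k.+1)%N by [].
  rewrite (bigD1 (Ordinal ik')) //= eqxx big1 ?addr0 => [|l].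
    rewrite -(eqn_add2l i) subnKC //; case: eqP => // _; exact: scaler0.
  by rewrite -val_eqE /= => /negPf ->; rewrite scale0r.
rewrite big1 => [|l _]; last by rewrite ltn_eqF ?scale0r // (leq_trans (ltn_ord l)).
by rewrite ltn_eqF // ltn_addr.
Qed.

End GradedAction.

(** * The associated graded algebra and its action on gr M *)

Section GradedCherednik.
Variables (R : realType) (n : nat) (W : finGroupType).
Variables (rho : mx_representation R [set: W]%G n) (B : 'M[R]_n).
Variables (S : {set W}) (alpha : W -> 'rV[R[i]]_n) (c : W -> R[i]).
Local Notation H := (cherednik rho B S alpha c).
Local Notation hx := (@hx R n W rho B S alpha c).
Local Notation hy := (@hy R n W rho B S alpha c).
Local Notation hw := (@hw R n W rho B S alpha c).
Local Notation hcst := (@hcst R n W rho B S alpha c).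
Local Notation px := (@px R n W rho B S alpha c).
Local Notation rhoC := (rhoC rho).
Local Notation poly := {mpoly R[i][n]}.
Local Notation poly2 := {mpoly R[i][n + n]}.
Local Notation fil := (cherednik_fil rho B S alpha c).
Local Notation gr := (gr_ring fil).
Local Notation sym d a := (gsym (reg_filtration fil) d a : gr).
Local Notation gr_poly := (@gr_poly R n W rho B S alpha c).

Lemma symM i j (a b : H) : fil i a -> fil j b -> sym i a * sym j b = sym (i + j)%N (a * b).
Proof. exact: (@gsymZ _ _ _ (reg_filtration fil)). Qed.

Definition grx x : gr := sym 1%N (hx x).
Definition gry y : gr := sym 1%N (hy y).
Definition grw w : gr := sym 0%N (hw w).
Definition grc k : gr := sym 0%N (hcst k).

Lemma gr_cstE k : gr_cst rho B S alpha c k = grc k.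
Proof. exact: symbE. Qed.

Lemma gr_xE x : gr_x rho B S alpha c x = grx x.
Proof. exact: symbE. Qed.

Lemma gr_yE y : gr_y rho B S alpha c y = gry y.
Proof. exact: symbE. Qed.

Lemma fil0 i : fil i 0.
Proof. exact: cfil0. Qed.

Lemma fil_cst k : fil 0 (hcst k). Proof. exact: cfil_cst. Qed.
Lemma fil_w w : fil 0 (hw w). Proof. exact: cfil_w. Qed.
Lemma fil_x x : fil 1 (hx x). Proof. exact: cfil_x. Qed.
Lemma fil_y y : fil 1 (hy y). Proof. exact: cfil_y. Qed.
Lemma filM i j a b : fil i a -> fil j b -> fil (i + j)%N (a * b).
Proof. exact: cfil_mul. Qed.

Lemma grcD k l : grc (k + l) = grc k + grc l.
Proof. by rewrite /grc cstD gsymD //; apply: fil_cst. Qed.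

Lemma grcM k l : grc (k * l) = grc k * grc l.
Proof. by rewrite /grc cstM symM //; apply: fil_cst. Qed.

Lemma grc1 : grc 1 = 1.
Proof. by rewrite -gr_cstE. Qed.

Lemma grw1 : grw 1 = 1.
Proof. by rewrite -grc1 /grw hw1. Qed.

Lemma grcC k a : grc k * a = a * grc k.
Proof.
have [N [u [hu ->]]] := graded_decomposition (a : graded (reg_filtration fil)).
rewrite mulr_sumr mulr_suml; apply: eq_bigr => d _.
by rewrite (symM (fil_cst k) (hu d)) (symM (hu d) (fil_cst k)) addn0 cstC.
Qed.

Lemma grxxC x x' : grx x * grx x' = grx x' * grx x.
Proof. by rewrite (symM (fil_x x) (fil_x x')) (symM (fil_x x') (fil_x x)) hxC. Qed.

Lemma gryyC y y' : gry y * gry y' = gry y' * gry y.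
Proof. by rewrite (symM (fil_y y) (fil_y y')) (symM (fil_y y') (fil_y y)) hyC. Qed.

(** The commutator y x - x y lies in degree 0, whereas symbols of degree 2 are taken modulo degree
    1. *)
Lemma grxyC x y : grx x * gry y = gry y * grx x.
Proof.
have [fx fy] := (fil_x x, fil_y y).
rewrite (symM fx fy) (symM fy fx); apply/esym.
apply: gsym_eq; [exact: (filM fy fx)|exact: (filM fx fy)|].
rewrite -[X in mfil_pred _ _ X]/(hy y * hx x - hx x * hy y) hyx /=.
apply: (@cfil_leq _ _ _ _ _ _ _ _ 0) => //; apply: cfil_add; first exact: cfil_cst.
elim/big_ind: _ => [|a b|s _]; [exact: cfil0|exact: cfil_add|].
exact: (cfil_mul (cfil_cst _ _ _ _ _ _) (cfil_w _ _ _ _ _ _)).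
Qed.

Lemma grwx w x : grw w * grx x = grx (x *m rhoC w^-1) * grw w.
Proof. by rewrite (symM (fil_w w) (fil_x x)) (symM (fil_x _) (fil_w w)) hwx addn0. Qed.

Lemma grwy w y : grw w * gry y = gry (rhoC w *m y) * grw w.
Proof. by rewrite (symM (fil_w w) (fil_y y)) (symM (fil_y _) (fil_w w)) hwy addn0. Qed.

Definition coord i : gr := match split i with
  | inl j => grx (delta_mx 0 j) | inr j => gry (delta_mx j 0) end.

Lemma coordC i j : coord i * coord j = coord j * coord i.
Proof.
rewrite /coord; case: (split i) => k; case: (split j) => l.
- exact: grxxC.
- exact: grxyC.
- by rewrite grxyC.
- exact: gryyC.
Qed.

Lemma gr_polyE f : gr_poly f = mev grc coord f.
Proof.
apply: eq_bigr => m _; rewrite gr_cstE; congr (_ * _); apply: eq_bigr => i _.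
rewrite /gr_coord /coord; by case: (split i) => j; rewrite ?gr_xE ?gr_yE.
Qed.

Lemma gr_polyD f g : gr_poly (f + g) = gr_poly f + gr_poly g.
Proof. by rewrite !gr_polyE (mevD _ grcD). Qed.

Lemma gr_polyM f g : gr_poly (f * g) = gr_poly f * gr_poly g.
Proof. by rewrite !gr_polyE (mevM grcD grcM grc1 grcC coordC). Qed.

Lemma gr_poly0 : gr_poly 0 = 0.
Proof. by rewrite gr_polyE mev0. Qed.

Lemma gr_polyX i : gr_poly 'X_i = coord i.
Proof. by rewrite gr_polyE (mevX _ grc1). Qed.

Lemma gr_polyXn f k : gr_poly (f ^+ k) = gr_poly f ^+ k.
Proof. by rewrite !gr_polyE (mevXn grcD grcM grc1 grcC coordC). Qed.

Lemma coord_l j : coord (lshift n j) = grx (delta_mx 0 j).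
Proof. by rewrite /coord (unsplitK (inl j)). Qed.

Lemma coord_r j : coord (rshift n j) = gry (delta_mx j 0).
Proof. by rewrite /coord (unsplitK (inr j)). Qed.

Lemma grx_gr_poly x f : grx x * gr_poly f = gr_poly f * grx x.
Proof.
rewrite gr_polyE (mev_comm grcD grcM grc1 grcC coordC) // => i.
by rewrite /coord; case: (split i) => j; [exact: grxxC|exact: grxyC].
Qed.

Lemma gry_gr_poly y f : gry y * gr_poly f = gr_poly f * gry y.
Proof.
rewrite gr_polyE (mev_comm grcD grcM grc1 grcC coordC) // => i.
by rewrite /coord; case: (split i) => j; [rewrite grxyC|exact: gryyC].
Qed.

(** Pullback along the projection of h + h^* onto h. *)
Definition liftx (f : poly) : poly2 := f \mPo [tuple 'X_(lshift n i) | i < n].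

Lemma gr_poly_liftx f : gr_poly (liftx f) = mev grc (fun i => grx (delta_mx 0 i)) f.
Proof.
rewrite gr_polyE (mev_comp grcD grcM grc1 grcC coordC).
by apply: eq_mev => i; rewrite tnth_mktuple (mevX _ grc1) coord_l.
Qed.

Lemma gr_poly_liftxX m : fil (mdeg m) (px 'X_[m]) /\
  gr_poly (liftx 'X_[m]) = sym (mdeg m) (px 'X_[m]).
Proof.
rewrite gr_poly_liftx pxE (mevXm _ grc1) (mevXm _ (cst1 _ _ _ _ _)) mdegE.
elim: (index_enum _) => [|i r [fr ih]].
  by rewrite !big_nil -grc1; split; [exact: (fil_cst 1)|].
rewrite !big_cons.
have [fi hi] : fil (m i) (hx (delta_mx 0 i) ^+ m i) /\
    grx (delta_mx 0 i) ^+ m i = sym (m i) (hx (delta_mx 0 i) ^+ m i).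
  elim: (m i) => [|k [fk hk]]; first by rewrite !expr0 -grc1; split; [exact: (fil_cst 1)|].
  by rewrite !exprS hk (symM (fil_x _) fk); split => //; exact: (filM (fil_x _) fk).
by rewrite ih hi (symM fi fr); split=> //; exact: (filM fi fr).
Qed.

Lemma gr_poly_homog d f : f \is d.-homog ->
  fil d (px f) /\ gr_poly (liftx f) = sym d (px f).
Proof.
move=> /dhomogP fd; rewrite [f]mpolyE.
rewrite /liftx raddf_sum px_sum /= gr_polyE (mev_sum _ grcD) /=.
rewrite !big_seq; elim/big_rec2: _ => [|m u x mf [hu hx]].
  by split; [exact: fil0|rewrite gsym0].
have [hm hm'] := gr_poly_liftxX m.
have md : mdeg m = d by apply: fd.
have fm : fil d (px (f@_m *: 'X_[m])) by rewrite pxZ -md; exact: (filM (fil_cst _) hm).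
split; first exact: (cfil_add fm hu).
rewrite gsymD // -hx; congr (_ + _).
rewrite comp_mpolyZ (mevZ _ grcD grcM) -gr_polyE hm' symM // ?add0n ?pxZ ?md //.
exact: fil_cst.
Qed.

Variables (M : lmodType H) (G : mod_filtration fil M).

Lemma gsym_act i j (a : H) (u : M) : fil i a -> G j u ->
  sym i a *: gsym G j u = gsym G (i + j)%N (a *: u).
Proof. exact: gsymZ. Qed.

Definition ann_gr (f : poly2) : Prop := forall u : graded G, gr_poly f *: u = 0.

Lemma ann_gr_ideal : is_ideal ann_gr.
Proof.
split=> [u|f g hf hg u|f g hf u]; first by rewrite gr_poly0 scale0r.
  by rewrite gr_polyD scalerDl hf hg addr0.
by rewrite gr_polyM -scalerA hf scaler0.
Qed.

(** Symbols of x and y commute with f, while those of W need not. The set [K] of vectors all of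
    whose W-translates are killed by f is nevertheless stable under the graded algebra, so it is
    enough to test the translates of generators. *)
Lemma ann_gr_generated f (e : seq (graded G)) :
  (forall u : graded G, exists a : nat -> gr, u = \sum_(i < size e) a i *: e`_i) ->
  (forall w i, (i < size e)%N -> gr_poly f *: (grw w *: e`_i) = 0) ->
  ann_gr f.
Proof.
move=> egen fe; pose K (u : graded G) := forall w, gr_poly f *: (grw w *: u) = 0.
have KD u u' : K u -> K u' -> K (u + u').
  by move=> h h' w; rewrite !scalerDr h h' addr0.
have KZ i a u : fil i a -> K u -> K (sym i a *: u).
  move=> ha; elim: ha u =>
    {i a} [k|w|x|y|i a b ha iha hb ihb|i j a b ha iha hb ihb|i a ha _] u Ku.
  - move=> w; rewrite -/(grc k) [grw w *: _]scalerA -grcC -scalerA scalerA -grcC.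
    by rewrite -scalerA Ku scaler0.
  - move=> w'; rewrite [grw w' *: _]scalerA (symM (fil_w w') (fil_w w)) -hwM.
    exact: Ku.
  - move=> w; rewrite -/(grx x) [grw w *: _]scalerA grwx -scalerA scalerA -grx_gr_poly.
    by rewrite -scalerA Ku scaler0.
  - move=> w; rewrite -/(gry y) [grw w *: _]scalerA grwy -scalerA scalerA -gry_gr_poly.
    by rewrite -scalerA Ku scaler0.
  - by rewrite gsymD // scalerDl; apply: KD; [exact: iha|exact: ihb].
  - by rewrite -(symM ha hb) -scalerA; apply/iha/ihb.
  - by move=> w; rewrite gsym_eq0 // scale0r !scaler0.
have KA (a : gr) u : K u -> K (a *: u).
  move=> Ku; have [N [b [hb ->]]] := graded_decomposition (a : graded (reg_filtration fil)).
  rewrite scaler_suml; elim/big_ind: _ => [w|u' v|i _].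
  - by rewrite !scaler0.
  - exact: KD.
  - exact: (KZ _ _ _ (hb i) Ku).
have Kall u : K u.
  have [a ->] := egen u; elim/big_ind: _ => [w|u' v|i _].
  - by rewrite !scaler0.
  - exact: KD.
  - by apply: KA => w; apply: fe.
by move=> u; have := Kall u 1%g; rewrite grw1 scale1r.
Qed.

(** The homogeneous components of f send one symbol to different degrees, so each of them kills it
    separately. *)
Lemma ann_gr_homog f d j u : ann_gr (liftx f) -> G j u ->
  mfil_pred G (d + j)%N (px (pihomog mdeg d f) *: u).
Proof.
move=> fann uj; pose N := maxn (msize f) d.+1.
pose h e := pihomog mdeg e f : poly.
have hfil e : fil e (px (h e)) by apply: (proj1 (gr_poly_homog _)); apply: pihomogP.
have fE : f = \sum_(e < N) h e by apply: pihomog_partitionE; apply: leq_maxl.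
have := fann (gsym G j u); rewrite {1}fE /liftx raddf_sum /= gr_polyE (mev_sum _ grcD).
rewrite scaler_suml => h0.
apply: (@gsym_shift_direct _ _ _ G j N (fun e => px (h e) *: u)).
- by move=> e; apply: mfilZ.
- rewrite -[RHS]h0; apply: eq_bigr => e _.
  by rewrite -gr_polyE (proj2 (gr_poly_homog (pihomogP _ _ _))) (gsym_act (hfil e) uj).
- by rewrite leq_maxr.
Qed.

End GradedCherednik.

(** * Computation of the support for an arbitrary good filtration *)

Section Support.
Variables (R : realType) (n : nat) (W : finGroupType).
Variables (rho : mx_representation R [set: W]%G n) (B : 'M[R]_n).
Variables (S : {set W}) (alpha : W -> 'rV[R[i]]_n) (c : W -> R[i]).
Hypothesis gramB : is_gram B.
Hypothesis reflS : forall s, s \in S -> is_reflection B (rho s).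
Hypothesis rootS : forall s, s \in S -> is_root rho s (alpha s).
Local Notation H := (cherednik rho B S alpha c).
Local Notation hy := (@hy R n W rho B S alpha c).
Local Notation hw := (@hw R n W rho B S alpha c).
Local Notation hcst := (@hcst R n W rho B S alpha c).
Local Notation px := (@px R n W rho B S alpha c).
Local Notation rhoC := (rhoC rho).
Local Notation wx := (wx rho).
Local Notation poly := {mpoly R[i][n]}.
Local Notation poly2 := {mpoly R[i][n + n]}.
Local Notation fil := (cherednik_fil rho B S alpha c).
Local Notation gr := (gr_ring fil).
Local Notation gr_poly := (@gr_poly R n W rho B S alpha c).
Local Notation root_mx := (root_mx alpha).
Variable M : lmodType H.
Hypothesis Msimple : simple_module M.
Variables (I : finType) (v : I -> M).
Hypothesis v0 : exists i, v i <> 0.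
Hypothesis vw : forall w i, spanned v (hw w *: v i).
Hypothesis vy : forall y i, spanned v (hy y *: v i).
Variable G : mod_filtration fil M.
Hypothesis Ggood : good_filtration G.
Local Notation xfil := (xfil v).
Local Notation repr_gr := (fun a : gr =>
  generic_quotient.repr (a : graded (reg_filtration fil))).
Local Notation repr_M := (fun u : graded G => generic_quotient.repr u).

Lemma family_bound (J : finType) (P : nat -> J -> Prop) :
  (forall d d' j, (d <= d')%N -> P d j -> P d' j) ->
  (forall j, exists d, P d j) -> exists d, forall j, P d j.
Proof.
move=> mono /choice[d hd]; exists (\max_j d j)%N => j.
by apply: (mono (d j)) => //; apply: (leq_bigmax j).
Qed.

Lemma rees_xfil (r : rees G) : exists k, forall l, xfil k (r l).
Proof.
have [N rN] := rees_fin r.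
have [k hk] : exists k, forall l : 'I_N, xfil k (r l).
  apply: family_bound => [d d' j|j]; first exact: xfil_leq.
  exact: xfil_exhaustive.
exists k => l; have [lN|Nl] := ltnP l N; first exact: (hk (Ordinal lN)).
by rewrite rN //; apply: xfil_leq (xfil_0 v).
Qed.

(** Representatives of the finitely many generators of gr M lie in one step k. Hence an element of
    G_j agrees modulo G_(j-1) with an element of degree at most j + k, and induction on j
    concludes. *)
Lemma mfil_xfil : exists k, forall j u, G j u -> xfil (j + k) u.
Proof.
have [e egen] := Ggood.
have [k hk] : exists k, forall i : 'I_(size e), forall l, xfil k (repr_M e`_i l).
  apply: family_bound => [d d' i dd h l|i]; last exact: rees_xfil.
  exact: xfil_leq dd (h l).
have step j u : G j u -> exists2 r, xfil (j + k) r & mfil_pred G j (u - r).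
  move=> uj; have [a aE] := egen (symb uj).
  pose f (i : 'I_(size e)) := rees_act (repr_gr (a i)) (repr_M e`_i).
  have [r rE rk] := pi_rees_sum (index_enum 'I_(size e)) f.
  have {aE rE} : symb uj = \pi_(graded G)%qT r by rewrite aE; apply/esym/rE.
  move=> /graded_eqP/(_ j) /=; rewrite eqxx => ur; exists (r j) => //.
  rewrite rk; elim/big_ind: _ => [|u1 u2|i _]; [exact: xfil_leq (xfil_0 v)|exact: xfil_add|].
  rewrite /= /conv; elim/big_ind: _ => [|u1 u2|t _];
    [exact: xfil_leq (xfil_0 v)|exact: xfil_add|].
  apply: (xfil_leq (d := (t + k)%N)); first by rewrite leq_add2r -ltnS ltn_ord.
  by apply: (xfil_alg vw vy) => //; apply: (reesP (repr_gr (a i))).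
exists k; elim=> [|j ih] u /step[r rx /= ur]; rewrite -(subrK r u).
  by rewrite ur add0r.
by apply: xfil_add rx; apply/xfil_S/ih.
Qed.

Lemma xfil_mfil : exists k, forall d u, xfil d u -> G (d + k)%N u.
Proof.
have mono d d' u : (d <= d')%N -> G d u -> G d' u.
  move=> /subnKC <-; elim: (d' - d)%N => [|l ih] h; first by rewrite addn0.
  by rewrite addnS; apply/mfilS/ih.
have [k hk] : exists k, forall i, G k (v i).
  by apply: family_bound => [d d' i|i]; [exact: mono|exact: mfil_exhaustive].
exists k => d u; elim=> {d u} [i||d u u' _ h _ h'|d l u _ h|d u _ h|d x u _ h].
- exact: hk.
- exact: mfil0.
- exact: mfilD.
- by apply: (mfilZ (i := 0%N)) => //; apply: fil_cst.
- by rewrite addSn; apply: mfilS.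
- by rewrite addSn -add1n; apply: mfilZ => //; apply: fil_x.
Qed.

(** As y preserves the degree in C[h], any power of it maps G_d into G_(d+k+l), where k and l are
    the two comparison shifts. For the exponent k + l + 1 this is one step below the expected
    degree. *)
Lemma y_nilpotent : exists L, forall j, ann_gr G ('X_(rshift n j) ^+ L).
Proof.
have [[k hk] [l hl]] := (mfil_xfil, xfil_mfil); exists (k + l).+1 => j x.
have symy e : fil e (hy (delta_mx j 0) ^+ e) /\
    gr_poly ('X_(rshift n j) ^+ e) = gsym (reg_filtration fil) e (hy (delta_mx j 0) ^+ e).
  rewrite gr_polyXn gr_polyX coord_r; elim: e => [|e [fe he]].
    by rewrite !expr0 -(grc1 rho B S alpha c); split=> //; exact: (fil_cst _ _ _ _ _ 1).
  rewrite !exprS he (symM (fil_y _ _ _ _ _ _) fe); split => //.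
  exact: (filM (fil_y _ _ _ _ _ _) fe).
have [N [u [hu ->]]] := graded_decomposition x.
rewrite scaler_sumr big1 // => d _.
rewrite (proj2 (symy _)) gsym_act //; last exact: (proj1 (symy _)).
apply: gsym_eq0; rewrite addSn /=.
have : forall e, xfil (d + k) (hy (delta_mx j 0) ^+ e *: u d).
  elim=> [|e ih]; first by rewrite expr0 scale1r; apply/hk/hu.
  by rewrite exprS -scalerA; apply: xfil_y.
by move=> /(_ (k + l).+1)/hl; rewrite -addnA addnC.
Qed.

Variable T : {set W}.
Hypothesis Tflat : is_support_flat M T.

(** The coordinates along [h^*] vanish at [p] because the y's are nilpotent on gr M. If the orbit of
    [a] avoided the flat, the orbit product of a generic combination of roots would be nonzero at
    [a], though a power of it kills the witness [u]. *)
Lemma support_sub p : gr_supp G p -> p.2 = 0 /\ exists w, root_mx T *m (rhoC w *m p.1) = 0.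
Proof.
case: p => a b [u hu] /=.
have cl j : coords (a, b) (lshift n j) = a j 0 by rewrite /coords (unsplitK (inl j)).
have cr j : coords (a, b) (rshift n j) = b 0 j by rewrite /coords (unsplitK (inr j)).
split.
  have [L hL] := y_nilpotent; apply/rowP => j; rewrite mxE.
  have := hu _ (hL j u); rewrite rmorphXn /= mevalXU cr => /eqP.
  by rewrite expf_eq0 => /andP[_ /eqP].
apply: contrapT => /forallNP h.
have [w|x xE] := @generic_root R n W rho alpha T a; first by apply/eqP/h.
pose f := \prod_w wx w (lin (x *m root_mx T)).
have fa : f.@[fun i => a i 0] != 0.
  rewrite /f rmorph_prod; apply/prodf_neq0 => w _ /=.
  by rewrite meval_sub_lin meval_lin -mulmxA; have := xE w^-1%g; rewrite -mulmxA.
have fh : f \is #|W|.-homog.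
  suff : f \is (\sum_(w : W) 1)%N.-homog by rewrite sum1_card.
  rewrite /f; elim/big_rec2: _ => [|w d g _ hg]; first exact: dhomog1.
  by apply: dhomogM => //; rewrite /wx sub_lin_lin lin_homog.
have [N [r [hr uE]]] := graded_decomposition u.
(* One exponent serves for the finitely many components of [u]. *)
have [K hK] : exists K, forall d : 'I_N, px (f ^+ K) *: r d = 0.
  apply: family_bound => [k k' d kk h'|d].
    by rewrite -(subnK kk) exprD pxM -scalerA h' scaler0.
  exact: (orbit_product_nilpotent gramB reflS rootS Tflat Msimple).
have fK : f ^+ K \is (#|W| * K).-homog by apply: dhomogMn.
have [ff fE] := gr_poly_homog rho B S alpha c fK.
have : gr_poly (liftx (f ^+ K)) *: u = 0.
  rewrite uE scaler_sumr big1 // => d _.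
  by rewrite fE gsym_act // hK gsym0.
move=> /hu; rewrite /liftx comp_mpoly_meval.
rewrite (meval_eq _ (v2 := fun i => a i 0)) => [|i]; last by rewrite tnth_mktuple mevalXU cl.
by rewrite rmorphXn /= => /eqP; rewrite expf_eq0 (negPf fa) andbF.
Qed.

(** Outside the support, some f killing gr M would be nonzero at the point. Modulo the nilpotent
    y's, f yields a polynomial on h, one of whose homogeneous components [h] is nonzero at [z] and
    lowers the filtration degree; this contradicts the vanishing of J on the translates of the
    flat. *)
Lemma support_sup w a : root_mx T *m a = 0 -> gr_supp G (rhoC w *m a, 0).
Proof.
move=> aT; set p := (_, _); set z := rhoC w *m a.
apply: contrapT => /forallNP noU.
have kill (u : graded G) : exists f : poly2, gr_poly f *: u = 0 /\ f.@[coords p] != 0.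
  have /existsNP[f /not_implyP[fu fp]] := noU u.
  by exists f; split=> //; apply/eqP.
have [e egen] := Ggood.
have /choice[k kE] := kill.
pose gw u i := (grw rho B S alpha c u : gr) *: (e`_i : graded G).
(* The product runs over the W-translates of a finite generating family, one factor killing each. *)
have [f fann fp] : exists2 f : poly2, ann_gr G f & f.@[coords p] != 0.
  exists (\prod_(q : W * 'I_(size e)) k (gw q.1 q.2)); last first.
    by rewrite rmorph_prod; apply/prodf_neq0 => q _; case: (kE (gw q.1 q.2)).
  apply: ann_gr_generated egen _ => u i ie.
  rewrite -/(gw u i) (bigD1 (u, Ordinal ie)) //= mulrC gr_polyM -scalerA.
  by case: (kE (gw u i)) => -> _; rewrite scaler0.
have iA := ann_gr_ideal G; have iR := radical_ideal iA; have [R0 RD RM] := iR.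
(* Setting the y's to 0 in f. *)
pose t : (n + n).-tuple poly :=
  [tuple match split i with inl j => 'X_j | inr _ => 0 end | i < n + n].
pose g := f \mPo t.
have gf : radical (ann_gr G) (f - liftx g).
  pose t' := [tuple liftx (tnth t i) | i < n + n].
  have -> : liftx g = f \mPo t' by apply: comp_mpoly_comp.
  have := comp_mpoly_congr R0 RD RM (t := [tuple 'X_i | i < n + n]) (t' := t') _ f.
  rewrite comp_mpoly_id; apply => i.
  rewrite !tnth_mktuple; case: (splitP i) => j ij.
    have -> : i = lshift n j by apply: val_inj.
    by rewrite /liftx comp_mpolyXU -tnth_nth tnth_mktuple subrr.
  have -> : i = rshift n j by apply: val_inj.
  rewrite /liftx comp_mpoly0 subr0.
  by have [L hL] := y_nilpotent; exists L; apply: hL.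
have [N gN] : radical (ann_gr G) (liftx g).
  have -> : liftx g = f - (f - liftx g) by rewrite opprB addrC subrK.
  exact: (idealB iR (sub_radical fann)).
have gz : g.@[fun i => z i 0] != 0.
  rewrite /g comp_mpoly_meval (meval_eq _ (v2 := coords p)) // => i.
  rewrite tnth_mktuple /coords; case: (split i) => j; first by rewrite mevalXU.
  by rewrite meval0 mxE.
have gNann : ann_gr G (liftx (g ^+ N)) by rewrite /liftx rmorphXn.
have [d hz] : exists d, (pihomog mdeg d (g ^+ N)).@[fun i => z i 0] != 0.
  apply: contrapT => /forallNP h0.
  have : (g ^+ N).@[fun i => z i 0] = 0.
    rewrite (pihomog_partitionE (k := msize (g ^+ N)) (leqnn _)) rmorph_sum big1 // => d _.
    by apply/eqP/negPn/negP/h0.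
  by move/eqP; rewrite rmorphXn expf_eq0 (negPf gz) andbF.
set h := pihomog _ _ _ in hz.
have hh : h \is d.-homog by apply: pihomogP.
have hG j u : G j u -> mfil_pred G (d + j)%N (px h *: u) by apply: ann_gr_homog.
(* In degree 0, [h] is a nonzero constant that sends each G_j into G_(j-1), which forces M = 0. *)
case: d @h hz hh hG => [|d] h hz hh hG.
  have hE : h = (h@_0%MM)%:MP.
    apply: mderiv_eq0_const => i; apply/mpolyP => m; rewrite mcoeff_deriv mcoeff0.
    by rewrite (dhomog_nemf_coeff hh) ?mul0rn //= mdegD mdeg1 addn1.
  have h0 : h@_0%MM != 0.
    by apply: contraNneq hz => h0; rewrite hE h0 mpolyC0 meval0.
  have unpred j u : mfil_pred G j (px h *: u) -> mfil_pred G j u.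
    move=> hp; have -> : u = hcst (h@_0%MM)^-1 *: (px h *: u).
      by rewrite hE pxC scalerA -cstM mcoeffC eqxx mulr1 mulVf // cst1 scale1r.
    by apply: (mfil_predZr (i := 0%N)) => //; apply: fil_cst.
  have G0 j u : G j u -> u = 0.
    elim: j u => [|j ih] u uj; first by have := unpred _ _ (hG _ _ uj).
    exact: ih (unpred _ _ (hG _ _ uj)).
  have [i vi] := v0; have [j vj] := mfil_exhaustive G (v i).
  by apply: vi; apply: G0 vj.
have [[k1 hk1] [k2 hk2]] := (mfil_xfil, xfil_mfil).
have hNG q j u : G j u -> G (q * d + j)%N (px (h ^+ q) *: u).
  elim: q => [|q ih] uj; first by rewrite expr0 px1 scale1r.
  by rewrite exprS pxM -scalerA mulSn -addnA; apply/hG/ih.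
(* Each factor [h] gains one degree; with [q] factors the gain exceeds the total shift k1 + k2
   between the two filtrations, as [leading_term_vanish] requires. *)
pose q := (k1 + k2).+1.
have := leading_term_vanish Msimple v0 vw vy (dhomogMn q hh) (e := (q * d + k2 + k1)%N).
move=> /(_ z) H0; have : (h ^+ q).@[fun i => z i 0] = 0.
  apply: H0.
  - by rewrite mulSn mulnC /q; lia.
  - move=> i; have vi : G k2 (v i) := hk2 0%N _ (xfil_gen v i).
    exact/hk1/hNG.
  (* The whole line through [z] lies in a translate of the flat. *)
  - move=> h' h'ann t0; rewrite /z scalemxAr.
    apply: (annx_vanish gramB reflS rootS Tflat w h'ann).
    by rewrite -scalemxAr aT scaler0.
by move/eqP; rewrite rmorphXn expf_eq0 (negPf hz) andbF.
Qed.

End Support.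

(** * Identification of the support with the saturation of a fixed space *)

Theorem theorem6p3p4 (R : realType) (n : nat) (B : 'M[R]_n)
    (W : finGroupType) (rho : mx_representation R [set: W]%G n)
    (S : {set W}) (alpha : W -> 'rV[R[i]]_n) (c : W -> R[i])
    (gramB : is_gram B)
    (faithful_rho : mx_faithful rho)
    (reflS : forall s, s \in S -> is_reflection B (rho s))
    (genS : <<S>>%g = [set: W]%SET)
    (conjS : forall s w, s \in S -> (s ^ w)%g \in S)
    (rootS : forall s, s \in S -> is_root rho s (alpha s))
    (invc : forall s w, s \in S -> c (s ^ w)%g = c s)
    (M : lmodType (cherednik rho B S alpha c)) :
  category_O M -> simple_module M ->
  exists P : {set W}, parabolic rho P /\
    forall G : mod_filtration (cherednik_fil rho B S alpha c) M,
      good_filtration G -> gr_supp G = saturation rho (fixed_space rho P).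
Proof.
move=> [_ lfM] Msimple; have [[m m0] _] := Msimple.
have [I [v [[i vi] vw vy]]] := exists_finite_module m lfM.
have v0 : exists i, v i <> 0 by exists i; rewrite vi.
have [T Tflat] := exists_support_flat (ex_intro _ m m0).
have [TS _ _] := Tflat.
have [P parP PE] := flat_parabolic gramB reflS rootS TS.
exists P; split=> // G Ggood; apply/seteqP; split=> [[a b] /=|_ [w [[a b] [[/= aP ->] ->]]]].
  move=> /(support_sub gramB reflS rootS Msimple v0 vw vy Ggood Tflat)[/= -> [w aT]].
  exists w^-1%g, (rhoC rho w *m a, 0); split; first by split => //; apply/PE.
  by rewrite /act_h -/(rhoC rho _) /act_hdual mul0mx mulmxA rhoVC mul1mx.
rewrite /act_hdual mul0mx.
by apply: (support_sup gramB reflS rootS Msimple v0 vw vy Ggood Tflat); apply/PE.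
Qed.
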